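(* Fix $\alpha,\beta,\epsilon>0$. (1) Let $s,l,b\in\mathbb{R}$ and suppose that $$\|un\|_{X^{s,b-1}_S}\lesssim\|u\|_{X^{s,b}_S}\|n\|_{X^{l,b}_W}\quad\text{for all }u,n\in C_c^\infty(\mathbb{T}\times\mathbb{R}).$$ Then $l\ge\max(2(b-1),-2b)\ge-1$ and $s-l\le\min(-4(b-1),4b)\le2$. (2) Let $s,l,b\in\mathbb{R}$ and $\rho\in(0,1]$ and suppose that $$\|D^\rho(u\overline v)\|_{X^{l,b-1}_W}\lesssim\|u\|_{X^{s,b}_S}\|v\|_{X^{s,b}_S}\quad\text{for all }u,v\in C_c^\infty(\mathbb{T}\times\mathbb{R}).$$ Then $2s-l-\rho\ge\max(2(b-1),-2b)\ge-1$ and $s-l\ge\max(\rho+4(b-1),\rho-4b)\ge-2+\rho$. Here $\lesssim$ means inequality up to a constant independent of the functions $u,n,v$.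
   Context: $\mathbb{T}=\mathbb{R}/2\pi\mathbb{Z}$, $\langle x\rangle=(1+x^2)^{1/2}$; $C_c^\infty(\mathbb{T}\times\mathbb{R})$ denotes complex-valued smooth compactly supported functions. With the spacetime Fourier transform $\hat f(k,\tau)=\frac1{4\pi^2}\int f(x,t)e^{-i(kx+\tau t)}dxdt$, $k\in\mathbb{Z}$, $\tau\in\mathbb{R}$, $$\|f\|_{X^{s,b}_S}=\|\langle k\rangle^s\langle\tau+\alpha k^2+\epsilon^2k^4\rangle^b\hat f(k,\tau)\|_{L^2_\tau l^2_k},\qquad\|f\|_{X^{l,b}_W}=\|\langle k\rangle^l\langle|\tau|-\beta|k|\langle\epsilon k\rangle\rangle^b\hat f(k,\tau)\|_{L^2_\tau l^2_k}.$$ $D^\rho=|\nabla|^\rho$ is the spatial Fourier multiplier with symbol $|k|^\rho$. *)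

(* Defs.v *)
From mathcomp Require Import all_boot all_order all_algebra.
From mathcomp Require Import all_classical all_reals all_analysis.
From mathcomp Require Export complex.

Set Implicit Arguments.
Unset Strict Implicit.
Unset Printing Implicit Defensive.

Import Order.TTheory GRing.Theory Num.Theory.
Import numFieldNormedType.Exports.

Local Open Scope classical_set_scope.
Local Open Scope ring_scope.
Local Open Scope complex_scope.

(* A function on T x R, with T = R/2piZ, is represented by its lift
   f : R * R -> R[i], (x, t) |-> f (x, t), which is 2pi-periodic in x. *)

(* C^n regularity on R^2 through iterated continuous partial derivatives. *)
Fixpoint Cn_fun {R : realType} (n : nat) (f : R * R -> R) : Prop :=
  match n with
  | 0%N => continuous f
  | m.+1 =>
      [/\ continuous f,
          (forall p, derivable f p (1, 0)) /\ Cn_fun m ('D_(1, 0) f) &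
          (forall p, derivable f p (0, 1)) /\ Cn_fun m ('D_(0, 1) f)]
  end.

Definition smooth_fun {R : realType} (f : R * R -> R) : Prop :=
  forall n, Cn_fun n f.

(* C_c^oo(T x R): since T is compact, a compact support is a support bounded
   in t. *)
Definition test_fun {R : realType} (f : R * R -> R[i]) : Prop :=
  [/\ forall t, periodic (fun x => f (x, t)) (pi *+ 2),
      smooth_fun (fun p => complex.Re (f p)),
      smooth_fun (fun p => complex.Im (f p)) &
      exists M : R, forall x t, M < `|t| -> f (x, t) = 0].

Definition japanese {R : realType} (x : R) : R := Num.sqrt (1 + x ^+ 2).

Definition expi {R : realType} (x : R) : R[i] := cos x +i* sin x.

Definition cintegral {R : realType} (A : set R) (f : R -> R[i]) : R[i] :=
  (\int[lebesgue_measure]_(x in A) complex.Re (f x))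
  +i* (\int[lebesgue_measure]_(x in A) complex.Im (f x)).

Definition climit {R : realType} (z : nat -> R[i]) : R[i] :=
  lim ((fun n => complex.Re (z n)) @ \oo)
  +i* lim ((fun n => complex.Im (z n)) @ \oo).

Definition spacetime_fourier {R : realType} (f : R * R -> R[i])
    (k : int) (tau : R) : R[i] :=
  ((4 * pi ^+ 2)^-1)%:C *
  cintegral setT (fun t => cintegral `[0, pi *+ 2] (fun x =>
    f (x, t) * expi (- (k%:~R * x + tau * t)))).

Definition space_fourier {R : realType} (f : R * R -> R[i])
    (k : int) (t : R) : R[i] :=
  ((pi *+ 2)^-1)%:C *
  cintegral `[0, pi *+ 2] (fun x => f (x, t) * expi (- (k%:~R * x))).

(* The sum over k in Z is the limit of the sums over -N <= k <= N, here
   reindexed by k = j - N; it converges absolutely when f is smooth in x. *)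
Definition absD {R : realType} (rho : R) (f : R * R -> R[i]) (p : R * R) :
    R[i] :=
  climit (fun N : nat => \sum_(0 <= j < N.*2.+1)
    (let k : int := j%:Z - N%:Z in
    (`|k%:~R : R| `^ rho)%:C * space_fourier f k p.2 * expi (k%:~R * p.1))).

Definition L2l2_norm {R : realType} (F : int -> R -> R) : \bar R :=
  Lnorm lebesgue_measure 2%:E (fun tau : R =>
    (esum [set: int] (fun k => (`|F k tau| ^+ 2)%:E) `^ 2^-1)%E).

Definition XS_norm {R : realType} (alpha eps s b : R) (f : R * R -> R[i]) :
    \bar R :=
  L2l2_norm (fun k tau =>
    japanese k%:~R `^ s *
    japanese (tau + alpha * k%:~R ^+ 2 + eps ^+ 2 * k%:~R ^+ 4) `^ b *
    ComplexField.Normc.normc (spacetime_fourier f k tau)).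

Definition XW_norm {R : realType} (beta eps l b : R) (f : R * R -> R[i]) :
    \bar R :=
  L2l2_norm (fun k tau =>
    japanese k%:~R `^ l *
    japanese (`|tau| - beta * `|k%:~R| * japanese (eps * k%:~R)) `^ b *
    ComplexField.Normc.normc (spacetime_fourier f k tau)).

(* Main.v *)
Require Import Defs.
From mathcomp Require Import all_boot all_order all_algebra.
From mathcomp Require Import all_classical all_reals all_analysis.
From mathcomp Require Import measurable_realfun ring lra zify.

(** Each estimate is tested on single modes.  Let h be a smooth bump supported
    in [0,1] and take the function e^(i(kx + tau t)) h(t).  Its spacetime
    Fourier transform lives on the one frequency k, where it is, up to a
    constant, the Fourier transform of h translated to tau.  The latter decays
    faster than any power, and both modulations are 1-Lipschitz in tau, so a
    norm with weights <k>^s <m(k, tau)>^b of such a mode is comparable to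
    <k>^s <m(k, tau0)>^b, the weight at the centre of the mode, uniformly in
    the frequencies (lemmas mod_norm_upper and mod_norm_lower).

    The product of two modes is a mode whose frequencies are the sums, with
    envelope h^2; conjugation negates the frequencies; and D^rho multiplies a
    mode by |k|^rho.  A bilinear estimate therefore forces an inequality
    between weights, for all integers k1, k2 and all reals tau1, tau2
    (schrodinger_necessary, wave_necessary).

    Write p(k) = alpha k^2 + eps^2 k^4 and w(k) = beta |k| <eps k>, which grow
    like k^4 and k^2.  Taking two of the three modulations to be zero leaves
    the third one equal to the resonance.  For the frequencies (-N, 2N; N)
    in the first estimate, and (N, -N; 2N) in the second, the resonance is
    w(2N) ~ N^2; for (0, N; N), respectively (N, 0; N), it is
    p(N) + w(N) or p(N) - w(N), both ~ N^4.  Placing the resonance on the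
    output or on an input function gives four inequalities between powers of N
    in each part, and N -> oo compares the exponents (schrodinger_exponents,
    wave_exponents).  The bounds by -1, 2 and -2 + rho hold for every b. *)

Set Implicit Arguments.
Unset Strict Implicit.
Unset Printing Implicit Defensive.

Import Order.TTheory GRing.Theory Num.Theory.
Import numFieldNormedType.Exports.

Local Open Scope classical_set_scope.
Local Open Scope ring_scope.
Local Open Scope complex_scope.

(* In ring_scope the usual notation for the derivative of a function denotes
   the formal derivative of a polynomial. *)
Local Notation d1 f := (@derive1 _ _ f).

(** * Smooth functions of one variable and a bump *)

Section Smooth1.
Context {R : realType}.
Implicit Types (f g h : R -> R) (n m : nat).

(** The same shape as Cn_fun in one variable; the base case keeps continuity,
    so that the top derivative can still be integrated. *)
Fixpoint smooth1 n h : Prop :=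
  if n is m.+1 then (forall x : R, derivable h x 1) /\ smooth1 m (d1 h)
  else continuous h.

Lemma is_derive_derive1 f f' : (forall x : R, is_derive x 1 f (f' x)) -> d1 f = f'.
Proof. by move=> ff'; apply/funext => x; rewrite derive1E; apply: derive_val. Qed.

Lemma smooth1S n f f' : (forall x : R, is_derive x 1 f (f' x)) -> smooth1 n f' ->
  smooth1 n.+1 f.
Proof.
move=> ff' sf'; split; last by rewrite (is_derive_derive1 ff').
by move=> x; apply: ex_derive.
Qed.

Lemma derivable1_continuous f : (forall x : R, derivable f x 1) -> continuous f.
Proof. by move=> df x; apply/differentiable_continuous/derivable1_diffP. Qed.

Lemma smooth1_continuous n f : smooth1 n f -> continuous f.
Proof. by case: n => // n [] /derivable1_continuous. Qed.

Lemma smooth1W n f : smooth1 n.+1 f -> smooth1 n f.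
Proof.
by elim: n f => [|n IHn] f [df sf]; [exact: derivable1_continuous|split=> //; exact: IHn].
Qed.

Lemma smooth1_is_derive n f : smooth1 n.+1 f ->
  forall x : R, is_derive x (1:R) f (d1 f x).
Proof. by move=> [df _] x; rewrite derive1E; apply/derivableP. Qed.

Lemma smooth1D n f g : smooth1 n f -> smooth1 n g -> smooth1 n (f \+ g).
Proof.
elim: n f g => [|n IHn] f g sf sg.
  by move=> x; apply: continuousD; [exact: sf|exact: sg].
apply: (smooth1S (f' := d1 f \+ d1 g)); last by apply: IHn; [case: sf|case: sg].
move=> x.
by have := smooth1_is_derive sf x; have := smooth1_is_derive sg x => ? ?; apply: is_deriveD.
Qed.

Lemma smooth1M n f g : smooth1 n f -> smooth1 n g -> smooth1 n (f \* g).
Proof.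
elim: n f g => [|n IHn] f g sf sg.
  by move=> x; apply: continuousM; [exact: sf|exact: sg].
apply: (smooth1S (f' := (f \* d1 g) \+ (g \* d1 f))); last first.
  by apply: smooth1D; apply: IHn; [exact: smooth1W|case: sg|exact: smooth1W|case: sf].
move=> x.
by have := smooth1_is_derive sf x; have := smooth1_is_derive sg x => ? ?; apply: is_deriveM.
Qed.

Lemma smooth1_cst n (a : R) : smooth1 n (fun=> a).
Proof.
elim: n a => [|n IHn] a; first by move=> x; exact: cvg_cst.
by apply: (smooth1S (f' := fun=> 0)).
Qed.

Lemma smooth1Z n (a : R) f : smooth1 n f -> smooth1 n (fun x => a * f x).
Proof. by move=> sf; apply: (@smooth1M _ (fun=> a)) => //; exact: smooth1_cst. Qed.

Lemma smooth1_onem n f : smooth1 n f -> smooth1 n (fun x => f (1 - x)).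
Proof.
elim: n f => [|n IHn] f sf.
  move=> x; apply: (@continuous_comp _ _ _ (fun x : R => 1 - x) f x); last exact: sf.
  by apply: cvgB; [exact: cvg_cst|exact: cvg_id].
apply: (smooth1S (f' := fun x => (-1) * d1 f (1 - x))); last first.
  by apply: smooth1Z; apply: IHn; case: sf.
move=> x.
have dx : is_derive x 1 (fun x : R => 1 - x) (-1).
  have := is_deriveB (is_derive_cst (1:R) x 1) (is_derive_id x 1); rewrite sub0r; exact.
have d2 := smooth1_is_derive sf (1 - x).
have := @is_derive1_comp _ f (fun x : R => 1 - x) x _ _ d2 dx.
by rewrite mulrC.
Qed.

(** The classical flat function e^(-1/x), together with the factors x^(-n) that
    its derivatives produce: this family is closed under differentiation. *)
Definition flat n (x : R) : R :=
  if 0 < x then x^-1 ^+ n * expR (- x^-1) else 0.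

(** The bound e^u >= u at u = y/n, raised to the power n. *)
Lemma exp_decay n (y : R) : 0 < y -> y ^+ n * expR (- y) <= n%:R ^+ n.
Proof.
case: n => [|n] y0; first by rewrite !expr0 mul1r expR_le1 oppr_le0 ltW.
have n0 : 0 < n.+1%:R :> R by rewrite ltr0n.
have -> : expR (- y) = (expR (y / n.+1%:R) ^+ n.+1)^-1.
  by rewrite -expRM_natl mulrC divfK ?gt_eqF// expRN.
rewrite ler_pdivrMr ?exprn_gt0 ?expR_gt0// -exprMn.
have yn : y <= n.+1%:R * expR (y / n.+1%:R).
  by rewrite -ler_pdivrMl// mulrC (le_trans _ (expR_ge1Dx _))// lerDr.
rewrite lerXn2r ?nnegrE // ?mulr_ge0 ?expR_ge0 ?(ltW y0)//.
Qed.

(** A quadratic bound is what makes the difference quotient at 0 vanish. *)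
Lemma flat_le n : exists2 K : R, 0 < K & forall x, `|flat n x| <= K * x ^+ 2.
Proof.
exists (n.+2%:R ^+ n.+2); first by rewrite exprn_gt0// ltr0n.
move=> x; rewrite /flat; case: ifPn => [x0|_]; last first.
  by rewrite normr0 mulr_ge0 ?sqr_ge0 ?exprn_ge0 ?ler0n.
have y0 : 0 < x^-1 by rewrite invr_gt0.
rewrite ger0_norm; last by rewrite mulr_ge0 ?expR_ge0 ?exprn_ge0 ?(ltW y0).
rewrite -ler_pdivrMr ?exprn_gt0//.
rewrite -exprVn mulrAC -exprD addn2; exact: exp_decay.
Qed.

(** The point 0 is the only one where the formula is not a local identity
    between elementary functions; there flat_le gives the derivative 0. *)
Lemma is_derive_flat n x :
  is_derive (x : R) 1 (flat n) (flat n.+2 x - n%:R * flat n.+1 x).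
Proof.
have [x0|x0|->] := ltrgtP x 0.
- rewrite /flat ltNge (ltW x0)/= mulr0 subr0.
  apply: (@near_eq_is_derive _ _ _ (fun=> 0:R)).
  near=> z; suff -> : (0 < z) = false by [].
  by apply/negbTE; rewrite -leNgt; apply: ltW; near: z; exact: lt_nbhsl.
- have xn0 : x != 0 by rewrite gt_eqF.
  have dV : is_derive x 1 (fun z : R => z^-1) (- x^-1 ^+ 2).
    apply: DeriveDef; first exact: derivableV.
    by rewrite deriveV// derive_id exprVn /GRing.scale/= mulr1.
  have dX : is_derive x 1 (fun z : R => z^-1 ^+ n) (- n%:R * x^-1 ^+ n.+1).
    have -> : (fun z : R => z^-1 ^+ n) = (fun z : R => z^-1) ^+ n.
      by apply/funext => z; rewrite exprfctE.
    apply: (is_derive_eq (is_deriveX _ _)); rewrite /= /GRing.scale/=.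
    by case: n => [|n] /=; rewrite ?exprS; ring.
  have dN : is_derive x 1 (fun z : R => - z^-1) (x^-1 ^+ 2).
    have -> : x^-1 ^+ 2 = - - x^-1 ^+ 2 by rewrite opprK.
    exact: is_deriveN.
  have dE := @is_derive1_comp _ expR (fun z : R => - z^-1) x _ _ (is_derive_expR (- x^-1)) dN.
  have dF := is_deriveM dX dE.
  apply: (near_eq_is_derive _ (is_derive_eq dF _)).
    near=> z; rewrite /flat; suff -> : (0 < z) = true by [].
    by near: z; exact: lt_nbhsr.
  by rewrite /flat x0 /= /GRing.scale/= !exprS; ring.
rewrite /flat ltxx mulr0 subr0.
have [K K0 HK] := flat_le n.
have cv : (fun h : R => h^-1 *: ((flat n \o shift 0) (h *: (1 : R)) - flat n 0)) @ 0^' --> (0 : R).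
  apply/cvgr0Pnorm_le => e e0; near=> h.
  have h0 : h != 0 by near: h; exact: nbhs_dnbhs_neq.
  rewrite /= addr0 /GRing.scale/= mulr1 {2}/flat ltxx subr0 normrM normfV.
  rewrite ler_pdivrMl ?normr_gt0// (le_trans (HK h))//.
  have : `|h| <= e / K by near: h; apply: dnbhs0_le; rewrite divr_gt0.
  rewrite ler_pdivlMr// => hK.
  by rewrite -(real_normK (num_real h)) expr2 mulrCA ler_pM2l ?normr_gt0// mulrC.
by apply: DeriveDef; [exact: cvgP cv|exact: cvg_lim cv].
Unshelve. all: by end_near. Qed.

Lemma smooth1_flat m n : smooth1 m (flat n).
Proof.
elim: m n => [|m IHm] n.
  by apply: derivable1_continuous => x; case: (is_derive_flat n x).
apply: (smooth1S (is_derive_flat n)).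
apply: (@smooth1D _ _ (fun x => - (n%:R * flat n.+1 x))) => //.
have -> : (fun x => - (n%:R * flat n.+1 x)) = (fun x => - n%:R * flat n.+1 x).
  by apply/funext => x; rewrite mulNr.
exact: smooth1Z.
Qed.

Definition bump (x : R) : R := flat 0 x * flat 0 (1 - x).

Lemma smooth1_bump m : smooth1 m bump.
Proof. by apply: smooth1M; [exact: smooth1_flat|apply: smooth1_onem; exact: smooth1_flat]. Qed.

Lemma bump_ge0 x : 0 <= bump x.
Proof.
by rewrite /bump /flat !expr0 !mul1r; apply: mulr_ge0; case: ifP; rewrite ?expR_ge0.
Qed.

Lemma bump_gt0 x : 0 < x < 1 -> 0 < bump x.
Proof.
move=> /andP[x0 x1].
by rewrite /bump /flat subr_gt0 x0 x1 !expr0 !mul1r mulr_gt0// expR_gt0.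
Qed.

Lemma bump_out x : ~~ (0 <= x <= 1) -> bump x = 0.
Proof.
rewrite negb_and -!ltNge /bump /flat subr_gt0 => /orP[x0|x1].
  by rewrite (lt_gtF x0) mul0r.
by rewrite (lt_gtF x1) mulr0.
Qed.

End Smooth1.

(** * Modes are test functions *)

Section Mode.
Context {R : realType}.
Implicit Types (h : R -> R) (k : int) (f : R * R -> R).

(** The difference quotient in the direction (1,0) only sees the first
    variable, so directional derivatives reduce to ordinary ones. *)
Lemma is_derive_slice1 f (p : R * R) (d : R) :
  is_derive p.1 1 (fun x => f (x, p.2)) d -> is_derive p (1, 0) f d.
Proof.
move=> [df vf].
have E : (fun h : R => h^-1 *: ((f \o shift p) (h *: (1, 0)) - f p)) =
   (fun h : R => h^-1 *: (((fun x => f (x, p.2)) \o shift p.1) (h *: (1 : R)) - f (p.1, p.2))).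
  apply/funext => h /=; congr (_ *: (f _ - f _)); last by case: p {df vf}.
  by congr pair; rewrite /= /GRing.scale/= mulr0 add0r.
by split; [rewrite /derivable E|rewrite /derive E].
Qed.

Lemma is_derive_slice2 f (p : R * R) (d : R) :
  is_derive p.2 1 (fun t => f (p.1, t)) d -> is_derive p (0, 1) f d.
Proof.
move=> [df vf].
have E : (fun h : R => h^-1 *: ((f \o shift p) (h *: (0, 1)) - f p)) =
   (fun h : R => h^-1 *: (((fun x => f (p.1, x)) \o shift p.2) (h *: (1 : R)) - f (p.1, p.2))).
  apply/funext => h /=; congr (_ *: (f _ - f _)); last by case: p {df vf}.
  by congr pair; rewrite /= /GRing.scale/= mulr0 add0r.
by split; [rewrite /derivable E|rewrite /derive E].
Qed.

(** Real and imaginary parts of modes both have this form, which is stable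
    under the two partial derivatives. *)
Definition wave (a b : R) h1 h2 (p : R * R) : R :=
  cos (a * p.1 + b * p.2) * h1 p.2 + sin (a * p.1 + b * p.2) * h2 p.2.

Lemma continuous_wave a b h1 h2 :
  continuous h1 -> continuous h2 -> continuous (wave a b h1 h2).
Proof.
move=> c1 c2 p.
have cl : {for p, continuous (fun p : R * R => a * p.1 + b * p.2)}.
  by apply: cvgD; apply: cvgM; [exact: cvg_cst|exact: cvg_fst|exact: cvg_cst|exact: cvg_snd].
have c1' : {for p, continuous (fun p : R * R => h1 p.2)}.
  by apply: (@continuous_comp _ _ _ snd h1 p); [exact: cvg_snd|exact: c1].
have c2' : {for p, continuous (fun p : R * R => h2 p.2)}.
  by apply: (@continuous_comp _ _ _ snd h2 p); [exact: cvg_snd|exact: c2].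
apply: cvgD; apply: cvgM => //.
  exact: (@continuous_comp _ _ _ (fun p : R * R => a * p.1 + b * p.2) cos p cl (@continuous_cos _ _)).
exact: (@continuous_comp _ _ _ (fun p : R * R => a * p.1 + b * p.2) sin p cl (@continuous_sin _ _)).
Qed.

Lemma is_derive_affine (a c x : R) : is_derive x 1 (fun z => a * z + c) a.
Proof.
apply: (is_derive_eq (is_deriveD (is_deriveZ a (is_derive_id x 1)) (is_derive_cst c x 1))).
by rewrite /GRing.scale/= mulr1 addr0.
Qed.

Lemma is_derive_cos_affine (a c x : R) :
  is_derive x 1 (fun z => cos (a * z + c)) (- a * sin (a * x + c)).
Proof.
apply: (is_derive_eq (@is_derive1_comp _ cos _ x _ _ (is_derive_cos _) (is_derive_affine a c x))).
by rewrite mulrC mulrN mulNr.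
Qed.

Lemma is_derive_sin_affine (a c x : R) :
  is_derive x 1 (fun z => sin (a * z + c)) (a * cos (a * x + c)).
Proof.
apply: (is_derive_eq (@is_derive1_comp _ sin _ x _ _ (is_derive_sin _) (is_derive_affine a c x))).
by rewrite mulrC.
Qed.

Lemma is_derive_wave1 (a b : R) h1 h2 (p : R * R) :
  is_derive p (1, 0) (wave a b h1 h2)
    (wave a b (fun t => a * h2 t) (fun t => - a * h1 t) p).
Proof.
apply: is_derive_slice1; rewrite /wave /=.
have dc := is_derive_cos_affine a (b * p.2) p.1.
have ds := is_derive_sin_affine a (b * p.2) p.1.
apply: (is_derive_eq (is_deriveD (is_deriveM dc (is_derive_cst (h1 p.2) p.1 1))
   (is_deriveM ds (is_derive_cst (h2 p.2) p.1 1)))).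
by rewrite /GRing.scale/=; ring.
Qed.

Lemma is_derive_wave2 (a b : R) h1 h2 (h1' h2' : R -> R) (p : R * R) :
  (forall t : R, is_derive t 1 h1 (h1' t)) -> (forall t : R, is_derive t 1 h2 (h2' t)) ->
  is_derive p (0, 1) (wave a b h1 h2)
    (wave a b (fun t => h1' t + b * h2 t) (fun t => h2' t + - b * h1 t) p).
Proof.
move=> dh1 dh2; apply: is_derive_slice2; rewrite /wave /=.
have dc : is_derive p.2 1 (fun t => cos (a * p.1 + b * t)) (- b * sin (a * p.1 + b * p.2)).
  rewrite addrC; have := is_derive_cos_affine b (a * p.1) p.2.
  by congr is_derive; apply/funext => t; rewrite addrC.
have ds : is_derive p.2 1 (fun t => sin (a * p.1 + b * t)) (b * cos (a * p.1 + b * p.2)).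
  rewrite addrC; have := is_derive_sin_affine b (a * p.1) p.2.
  by congr is_derive; apply/funext => t; rewrite addrC.
apply: (is_derive_eq (is_deriveD (is_deriveM dc (dh1 p.2)) (is_deriveM ds (dh2 p.2)))).
by rewrite /GRing.scale/=; ring.
Qed.

Lemma Cn_wave n a b h1 h2 : smooth1 n h1 -> smooth1 n h2 -> Cn_fun n (wave a b h1 h2).
Proof.
elim: n h1 h2 => [|n IHn] h1 h2 s1 s2; first exact: continuous_wave.
split.
- by apply: continuous_wave; [exact: smooth1_continuous s1|exact: smooth1_continuous s2].
- split=> [p|]; first by case: (is_derive_wave1 a b h1 h2 p).
  have -> : 'D_(1, 0) (wave a b h1 h2) = wave a b (fun t => a * h2 t) (fun t => - a * h1 t).
    by apply/funext => p; case: (is_derive_wave1 a b h1 h2 p).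
  by apply: IHn; apply: smooth1Z; apply: smooth1W.
- have D := is_derive_wave2 a b _ (smooth1_is_derive s1) (smooth1_is_derive s2).
  split=> [p|]; first by case: (D p).
  have -> : 'D_(0, 1) (wave a b h1 h2) =
      wave a b (fun t => d1 h1 t + b * h2 t) (fun t => d1 h2 t + - b * h1 t).
    by apply/funext => p; case: (D p).
  apply: IHn; apply: smooth1D; [by case: s1| |by case: s2|];
    by apply: smooth1Z; exact: smooth1W.
Qed.

Lemma periodic_int (f : R -> R) (T : R) k x :
  periodic f T -> f (x + k%:~R * T) = f x.
Proof.
move=> pf.
have nat_ n y : f (y + n%:R * T) = f y.
  by rewrite mulr_natl; exact: periodicn.
case: k => n; first exact: nat_.
by rewrite NegzE mulrNz mulNr -[LHS](nat_ n.+1) subrK.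
Qed.

Lemma expiD (a b : R) : expi (a + b) = expi a * expi b.
Proof. by rewrite /expi cosD sinD; simpc; congr (_ +i* _); rewrite addrC mulrC. Qed.

Definition mode k (tau : R) h (p : R * R) : R[i] :=
  expi (k%:~R * p.1 + tau * p.2) * (h p.2)%:C.

Lemma Re_mode k tau h p :
  complex.Re (mode k tau h p) = wave k%:~R tau h (fun=> 0) p.
Proof. by rewrite /mode /wave /= !mulr0 subr0 addr0. Qed.

Lemma Im_mode k tau h p :
  complex.Im (mode k tau h p) = wave k%:~R tau (fun=> 0) h p.
Proof. by rewrite /mode /wave /= !mulr0. Qed.

Lemma test_fun_mode k tau h (M : R) : (forall n, smooth1 n h) ->
  (forall t, M < `|t| -> h t = 0) -> test_fun (mode k tau h).
Proof.
move=> sh h0; split.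
- move=> t x; rewrite /mode /=; congr (_ * _).
  have -> : k%:~R * (x + pi *+ 2) + tau * t = (k%:~R * x + tau * t) + k%:~R * (pi *+ 2).
    by rewrite mulrDr addrAC.
  by rewrite /expi !periodic_int//; [exact: sinD2pi|exact: cosD2pi].
- move=> n.
  have -> : (fun p => complex.Re (mode k tau h p)) = wave k%:~R tau h (fun=> 0).
    by apply/funext => p; exact: Re_mode.
  by apply: Cn_wave => //; exact: smooth1_cst.
- move=> n.
  have -> : (fun p => complex.Im (mode k tau h p)) = wave k%:~R tau (fun=> 0) h.
    by apply/funext => p; exact: Im_mode.
  by apply: Cn_wave => //; exact: smooth1_cst.
- by exists M => x t Mt; rewrite /mode /= h0// mulr0.
Qed.

Lemma modeM k1 k2 tau1 tau2 h1 h2 :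
  (fun p => mode k1 tau1 h1 p * mode k2 tau2 h2 p) =
  mode (k1 + k2) (tau1 + tau2) (h1 \* h2).
Proof.
apply/funext => p; rewrite /mode rmorphD/= [(_ + _) * p.1]mulrDl [(_ + _) * p.2]mulrDl addrACA rmorphM/=.
by rewrite [in RHS]expiD mulrACA.
Qed.

Lemma mode_conj k tau h :
  (fun p => ((mode k tau h p)^*)%C) = mode (- k) (- tau) h.
Proof.
apply/funext => p; rewrite /mode rmorphM/= rmorphN/= !mulNr -opprD /expi cosN sinN.
by simpc.
Qed.

End Mode.

(** * Fourier transform of a mode *)

Section Fourier.
Context {R : realType}.
Implicit Types (f F h : R -> R) (k m : int).
Local Notation mu := (@lebesgue_measure R).

Lemma integrable_itv f (a b : R) : continuous f -> mu.-integrable `[a, b] (EFin \o f).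
Proof.
move=> cf; apply: continuous_compact_integrable; first exact: segment_compact.
exact: continuous_subspaceT.
Qed.

Lemma Rintegral_FTC f F (a b : R) : a < b -> continuous f ->
  (forall x : R, is_derive x 1 F (f x)) ->
  \int[mu]_(x in `[a, b]) f x = F b - F a.
Proof.
move=> ab cf dF.
have cF : continuous F by apply: derivable1_continuous => x; case: (dF x).
rewrite /Rintegral (@continuous_FTC2 _ f F a b)//.
- exact: continuous_subspaceT.
- split=> [x _||]; first by case: (dF x).
  + by apply: cvg_at_right_filter; exact: cF.
  + by apply: cvg_at_left_filter; exact: cF.
- by move=> x _; rewrite (is_derive_derive1 dF).
Qed.

Lemma continuous_cosM (a : R) : continuous (fun x => cos (a * x)).
Proof.
move=> x; apply: (@continuous_comp _ _ _ (fun x => a * x) cos x); last exact: continuous_cos.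
by apply: cvgM; [exact: cvg_cst|exact: cvg_id].
Qed.

Lemma continuous_sinM (a : R) : continuous (fun x => sin (a * x)).
Proof.
move=> x; apply: (@continuous_comp _ _ _ (fun x => a * x) sin x); last exact: continuous_sin.
by apply: cvgM; [exact: cvg_cst|exact: cvg_id].
Qed.

Lemma is_derive_cosM (a x : R) : is_derive x 1 (fun z => cos (a * z)) (- a * sin (a * x)).
Proof.
have := is_derive_cos_affine a 0 x; rewrite addr0.
by congr is_derive; apply/funext => z; rewrite addr0.
Qed.

Lemma is_derive_sinM (a x : R) : is_derive x 1 (fun z => sin (a * z)) (a * cos (a * x)).
Proof.
have := is_derive_sin_affine a 0 x; rewrite addr0.
by congr is_derive; apply/funext => z; rewrite addr0.
Qed.

(** Orthogonality of characters on the circle. *)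
Lemma Rintegral_trig m (a b : R) :
  \int[mu]_(x in `[0, pi *+ 2]) (a * cos (m%:~R * x) + b * sin (m%:~R * x)) =
  (if m == 0 then pi *+ 2 else 0) * a.
Proof.
have pi20 : 0 < pi *+ 2 :> R by rewrite pmulrn_lgt0// pi_gt0.
have [->|m0] := eqVneq m 0.
  under eq_Rintegral do rewrite mul0r cos0 sin0 mulr1 mulr0 addr0.
  have dF (x : R) : is_derive x 1 (fun x => a * x) a.
    apply: (is_derive_eq (is_deriveZ a (is_derive_id x 1))).
    by rewrite /GRing.scale/= mulr1.
  rewrite (Rintegral_FTC pi20 _ dF); first by rewrite mulr0 subr0 mulrC.
  by move=> x; exact: cvg_cst.
have mR : m%:~R != 0 :> R by rewrite intr_eq0.
pose F (x : R) := a / m%:~R * sin (m%:~R * x) - b / m%:~R * cos (m%:~R * x).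
have dF (x : R) : is_derive x 1 F (a * cos (m%:~R * x) + b * sin (m%:~R * x)).
  have ds := is_derive_sinM m%:~R x; have dc := is_derive_cosM m%:~R x.
  apply: (is_derive_eq (is_deriveB (is_deriveZ (a / m%:~R) ds) (is_deriveZ (b / m%:~R) dc))).
  by rewrite /GRing.scale/=; field.
rewrite (Rintegral_FTC pi20 _ dF) /F.
  have := @periodic_int R sin (pi *+ 2) m 0 (@sinD2pi R).
  have := @periodic_int R cos (pi *+ 2) m 0 (@cosD2pi R).
  by rewrite !add0r mulr0 => -> ->; rewrite subrr mul0r.
move=> x; apply: cvgD; apply: cvgM; [exact: cvg_cst|exact: continuous_cosM|
    exact: cvg_cst|exact: continuous_sinM].
Qed.

Lemma cintegral_char m (z : R[i]) :
  cintegral `[0, pi *+ 2] (fun x => expi (m%:~R * x) * z) =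
  (if m == 0 then pi *+ 2 else 0)%:C * z.
Proof.
case: z => a b; rewrite /cintegral /expi.
rewrite (_ : (fun x => complex.Re _) = (fun x => a * cos (m%:~R * x) + - b * sin (m%:~R * x))); last first.
  by apply/funext => x /=; ring.
rewrite (_ : (fun x => complex.Im _) = (fun x => b * cos (m%:~R * x) + a * sin (m%:~R * x))); last first.
  by apply/funext => x /=; ring.
by rewrite !Rintegral_trig; simpc.
Qed.

Lemma space_fourier_mode k0 tau h k t :
  space_fourier (mode k0 tau h) k t = (k == k0)%:R * (expi (tau * t) * (h t)%:C).
Proof.
rewrite /space_fourier (_ : (fun x => _) = fun x => expi ((k0 - k)%:~R * x) * (expi (tau * t) * (h t)%:C)).
  rewrite cintegral_char subr_eq0 eq_sym mulrA; congr (_ * _).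
  case: eqP => _; last by rewrite mulr0.
  by rewrite -rmorphM/= mulVf// gt_eqF// pmulrn_lgt0// pi_gt0.
apply/funext => x; rewrite /mode /= rmorphB/= mulrBl !expiD.
by rewrite -!mulrA; congr (_ * _); rewrite [RHS]mulrC mulrA.
Qed.

(** The interval [-1,2] contains [0,1] in its interior: a function supported in
    [0,1] then vanishes at both ends without any continuity argument, and so
    do all its derivatives. *)
Definition fcos h (sigma : R) : R := \int[mu]_(t in `[-1, 2]) (h t * cos (sigma * t)).
Definition fsin h (sigma : R) : R := \int[mu]_(t in `[-1, 2]) (h t * sin (sigma * t)).

Definition supported01 h := forall t, ~~ (0 <= t <= 1) -> h t = 0.

Lemma Rintegral_supported h g : supported01 h -> continuous h -> continuous g -> forall c : R,
  \int[mu]_t (c * (h t * g t)) = c * \int[mu]_(t in `[-1, 2]) (h t * g t).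
Proof.
move=> h0 ch cg c; rewrite -RintegralZl//; last first.
  by apply: integrable_itv => x; apply: cvgM; [exact: ch|exact: cg].
rewrite [RHS]Rintegral_mkcond; apply: eq_Rintegral => t _.
rewrite patchE; case: ifPn => //; rewrite notin_setE/= in_itv/= => /negP t12.
rewrite h0 ?mul0r ?mulr0//; apply: contra t12 => /andP[? ?].
by apply/andP; split; lra.
Qed.

(** The constant is 2 pi, from the integral over the circle, divided by 4 pi^2. *)
Lemma normc_spacetime_fourier_mode k0 tau0 h k tau : continuous h -> supported01 h ->
  ComplexField.Normc.normc (spacetime_fourier (mode k0 tau0 h) k tau) =
  (k == k0)%:R * ((pi *+ 2)^-1 * Num.sqrt (fcos h (tau0 - tau) ^+ 2 + fsin h (tau0 - tau) ^+ 2)).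
Proof.
move=> ch h0; rewrite /spacetime_fourier.
set c : R := if k == k0 then pi *+ 2 else 0.
rewrite (_ : (fun t => _) = fun t => c%:C * (expi ((tau0 - tau) * t) * (h t)%:C)); last first.
  apply/funext => t.
  rewrite (_ : (fun x => _) = fun x => expi ((k0 - k)%:~R * x) * (expi ((tau0 - tau) * t) * (h t)%:C)).
    by rewrite cintegral_char subr_eq0 eq_sym.
  apply/funext => x; rewrite /mode /= rmorphB/= mulrAC -expiD mulrA -expiD.
  by congr (expi _ * _); ring.
rewrite /cintegral /expi.
rewrite (_ : (fun t => complex.Re _) = fun t => c * (h t * cos ((tau0 - tau) * t))); last first.
  by apply/funext => t /=; ring.
rewrite (_ : (fun t => complex.Im _) = fun t => c * (h t * sin ((tau0 - tau) * t))); last first.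
  by apply/funext => t /=; ring.
rewrite !Rintegral_supported//; [|exact: continuous_sinM|exact: continuous_cosM].
rewrite -/(fcos _ _) -/(fsin _ _).
set X := fcos _ _; set Y := fsin _ _.
have pi0 : 0 < pi :> R by exact: pi_gt0.
have c0 : 0 <= c by rewrite /c; case: ifP => // _; rewrite mulrn_wge0// ltW.
simpc; rewrite /ComplexField.Normc.normc.
set A := (_^-1 : R).
have -> : (A * (c * X)) ^+ 2 + (A * (c * Y)) ^+ 2 = (A * c) ^+ 2 * (X ^+ 2 + Y ^+ 2) by ring.
rewrite sqrtrM ?sqr_ge0// sqrtr_sqr ger0_norm; last first.
  by rewrite mulr_ge0// invr_ge0 mulr_ge0// sqr_ge0.
rewrite mulrA /c; case: eqP => _; last by rewrite mulr0 !mul0r.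
rewrite mul1r; congr (_ * _); rewrite /A; move: (pi : R) pi0 => p p0.
by rewrite -(mulr_natl p 2); field; rewrite gt_eqF.
Qed.

(** Only the term j = N + k of the symmetric partial sums is nonzero, so they
    are constant from the index |k| on. *)
Lemma absD_mode (rho : R) k tau h :
  absD rho (mode k tau h) = mode k tau (fun t => `|k%:~R| `^ rho * h t).
Proof.
apply/funext => -[x t]; rewrite /absD.
set z := mode _ _ _ _.
pose S (N : nat) := \sum_(0 <= j < N.*2.+1)
    (let k' : int := j%:Z - N%:Z in
    (`|k'%:~R : R| `^ rho)%:C * space_fourier (mode k tau h) k' t * expi (k'%:~R * x)).
have SE N : (absz k <= N)%N -> S N = z.
  move=> kN; rewrite /S.
  have [j [jN jE]] : exists j : nat, (j < N.*2.+1)%N /\ j%:Z - N%:Z = k.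
    exists (absz (k + N%:Z)); move: kN; rewrite -addnn; lia.
  rewrite (bigD1_seq j) ?iota_uniq ?mem_index_iota//= big1 ?addr0.
    rewrite jE space_fourier_mode eqxx mul1r /z /mode /= expiD rmorphM/=.
    by rewrite mulrC !mulrA (mulrAC _ _%:C).
  move=> i ij; rewrite space_fourier_mode.
  have -> : (i%:Z - N%:Z == k) = false.
    by apply/negbTE; apply: contra ij => /eqP; lia.
  by rewrite mul0r mulr0 mul0r.
have cst_lim (f : R[i] -> R) : lim ((fun n => f (S n)) @ \oo) = f z.
  apply: lim_near_cst => //.
  by exists (absz k) => // n /= kn; rewrite SE.
by rewrite /climit !cst_lim; case: z {SE cst_lim}.
Qed.

End Fourier.

(** * Decay and lower bound for the transform of the envelope *)

Section Decay.
Context {R : realType}.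
Implicit Types (f h : R -> R).
Local Notation mu := (@lebesgue_measure R).

Lemma japanese_ge1 (x : R) : 1 <= japanese x.
Proof.
rewrite -[leLHS]sqrtr1 /japanese ler_sqrt ?lerDl ?sqr_ge0//.
by rewrite addr_ge0 ?sqr_ge0.
Qed.

Lemma japanese_gt0 (x : R) : 0 < japanese x.
Proof. exact: lt_le_trans (japanese_ge1 x). Qed.

Lemma sqr_japanese (x : R) : japanese x ^+ 2 = 1 + x ^+ 2.
Proof. by rewrite sqr_sqrtr// addr_ge0 ?sqr_ge0. Qed.

Lemma normr_le_japanese (x : R) : `|x| <= japanese x.
Proof. by rewrite -sqrtr_sqr /japanese ler_wsqrtr// lerDr. Qed.

Lemma japanese_le (x : R) : japanese x <= 1 + `|x|.
Proof.
rewrite -(@ler_pXn2r _ 2) ?nnegrE ?(ltW (japanese_gt0 _)) ?addr_ge0//.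
rewrite sqr_japanese sqrrD real_normK ?num_real// expr1n mul1r.
by rewrite lerD2r lerDl mulrn_wge0.
Qed.

(** The complement of [0,1] is open, so near each of its points h is zero. *)
Lemma supported01_derive1 h : supported01 h -> supported01 (d1 h).
Proof.
move=> h0 t; rewrite negb_and -!ltNge => t01.
have : \forall z \near t, cst 0 z = h z.
  case/orP: t01 => t1; near=> z; rewrite h0// negb_and -!ltNge.
    by apply/orP; left; near: z; exact: lt_nbhsl.
  by apply/orP; right; near: z; exact: lt_nbhsr.
by move=> /near_eq_derive; rewrite derive1E => <-; rewrite derive_cst.
Unshelve. all: by end_near. Qed.

Lemma continuous_normr f : continuous f -> continuous (fun t => `|f t|).
Proof. by move=> cf x; apply: cvg_norm; exact: cf. Qed.

Lemma fcos_fsin_bound h : continuous h ->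
  exists2 M, 0 <= M & forall sigma, `|fcos h sigma| <= M /\ `|fsin h sigma| <= M.
Proof.
move=> ch; have cnh := continuous_normr ch.
exists (\int[mu]_(t in `[-1, 2]) `|h t|); first by apply: Rintegral_ge0.
have B (g : R -> R) : continuous g -> (forall x, `|g x| <= 1) ->
    `|\int[mu]_(t in `[-1, 2]) (h t * g t)| <= \int[mu]_(t in `[-1, 2]) `|h t|.
  move=> cg g1; have chg : continuous (fun t => h t * g t).
    by move=> x; apply: cvgM; [exact: ch|exact: cg].
  apply: (le_trans (le_normr_Rintegral _ _)) => //; first exact: integrable_itv.
  apply: le_Rintegral => //; [|exact: integrable_itv|].
    by apply: integrable_itv; exact: continuous_normr.
  by move=> x _; rewrite normrM ler_piMr.
by move=> s; split; apply: B => [|x]; [exact: continuous_cosM|exact: cos_max|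
  exact: continuous_sinM|exact: sin_max].
Qed.

(** Integration by parts: the boundary terms vanish, and a derivative becomes a
    factor s. *)
Lemma fcos_fsin_derive h (s : R) : smooth1 1 h -> supported01 h ->
  fcos (d1 h) s = s * fsin h s /\ fsin (d1 h) s = - s * fcos h s.
Proof.
move=> sh h0.
have ch := smooth1_continuous sh; have ch' : continuous (d1 h) by case: sh.
have dh := smooth1_is_derive sh.
have lt12 : -1 < 2 :> R by lra.
have hN1 : h (-1) = 0 by apply: h0; rewrite negb_and -!ltNge; apply/orP; left; lra.
have h2 : h 2 = 0 by apply: h0; rewrite negb_and -!ltNge; apply/orP; right; lra.
have cM (f g : R -> R) : continuous f -> continuous g -> continuous (fun t => f t * g t).
  by move=> cf cg x; apply: cvgM; [exact: cf|exact: cg].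
have cc := @continuous_cosM R s; have cs := @continuous_sinM R s.
have i0 (f g : R -> R) : continuous f -> continuous g ->
    mu.-integrable `[-1, 2] (EFin \o (fun t => f t * g t)).
  by move=> cf cg; apply: integrable_itv; exact: cM.
split.
- have dF (t : R) : is_derive t 1 (fun t => h t * cos (s * t))
      (d1 h t * cos (s * t) + (- s) * (h t * sin (s * t))).
    apply: (is_derive_eq (is_deriveM (dh t) (is_derive_cosM s t))).
    by rewrite /GRing.scale/=; ring.
  have := Rintegral_FTC lt12 _ dF; rewrite hN1 h2 !mul0r subrr.
  rewrite RintegralD//; first 1 last.
  + exact: i0.
  + by apply: (i0 (fun=> - s) (fun t => h t * sin (s * t))); [move=> x; exact: cvg_cst|exact: cM].
  rewrite RintegralZl//; last exact: i0.
  rewrite -/(fcos (d1 h) s) -/(fsin h s) mulNr => H; apply/eqP; rewrite -subr_eq0; apply/eqP.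
  apply: H => x; apply: cvgD; first by apply: (cM _ _ ch' cc).
  by apply: cvgM; [exact: cvg_cst|apply: (cM _ _ ch cs)].
- have dF (t : R) : is_derive t 1 (fun t => h t * sin (s * t))
      (d1 h t * sin (s * t) + s * (h t * cos (s * t))).
    apply: (is_derive_eq (is_deriveM (dh t) (is_derive_sinM s t))).
    by rewrite /GRing.scale/=; ring.
  have := Rintegral_FTC lt12 _ dF; rewrite hN1 h2 !mul0r subrr.
  rewrite RintegralD//; first 1 last.
  + exact: i0.
  + by apply: (i0 (fun=> s) (fun t => h t * cos (s * t))); [move=> x; exact: cvg_cst|exact: cM].
  rewrite RintegralZl//; last exact: i0.
  rewrite -/(fsin (d1 h) s) -/(fcos h s) => H; apply/eqP; rewrite mulNr -addr_eq0; apply/eqP.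
  apply: H => x; apply: cvgD; first by apply: (cM _ _ ch' cs).
  by apply: cvgM; [exact: cvg_cst|apply: (cM _ _ ch cc)].
Qed.

(** Iterating the integration by parts n times trades n derivatives for n
    powers of the frequency. *)
Lemma fcos_fsin_decay n h : smooth1 n h -> supported01 h ->
  exists2 M, 0 <= M & forall sigma,
    `|sigma| ^+ n * `|fcos h sigma| <= M /\ `|sigma| ^+ n * `|fsin h sigma| <= M.
Proof.
elim: n h => [|n IHn] h sh h0.
  have [M M0 HM] := fcos_fsin_bound sh.
  by exists M => // s; rewrite expr0 !mul1r.
have [M M0 HM] := IHn (d1 h) (proj2 sh) (supported01_derive1 h0).
exists M => // s; have [Hc Hs] := HM s.
have sh1 : smooth1 1 h.
  elim: n {IHn M M0 HM Hc Hs} sh => // n IH sh; apply: IH; exact: smooth1W.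
have [Ec Es] := fcos_fsin_derive s sh1 h0.
rewrite Ec Es !normrM normrN in Hc Hs.
by split; rewrite exprSr -mulrA.
Qed.

(** The modulus of the Fourier transform of h at the frequency s. *)
Definition amplitude h (s : R) : R := Num.sqrt (fcos h s ^+ 2 + fsin h s ^+ 2).

Lemma amplitude_ge0 h s : 0 <= amplitude h s.
Proof. exact: sqrtr_ge0. Qed.

Lemma amplitude_le h s : amplitude h s <= `|fcos h s| + `|fsin h s|.
Proof.
rewrite /amplitude -(@ler_pXn2r _ 2) ?nnegrE ?sqrtr_ge0 ?addr_ge0//.
rewrite sqr_sqrtr ?addr_ge0 ?sqr_ge0// sqrrD !real_normK ?num_real//.
by rewrite -addrA lerD2l lerDr mulrn_wge0// mulr_ge0.
Qed.

(** Decay of integer order n >= r for |s| >= 1, boundedness for |s| <= 1. *)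
Lemma amplitude_decay h (r : R) : (forall n, smooth1 n h) -> supported01 h ->
  exists2 K, 0 < K & forall s, japanese s `^ r * amplitude h s <= K.
Proof.
move=> sh h0.
pose n := Num.bound `|r|.
have rn : r <= n%:R by apply: (le_trans (ler_norm r)); apply: ltW; apply: archi_boundP.
have [M0 M00 HM0] := fcos_fsin_decay (sh 0%N) h0.
have [M M0' HM] := fcos_fsin_decay (sh n) h0.
(* The summand 1 only makes the constant positive. *)
exists (2 ^+ n * (2 * (M0 + M)) + 1); first by rewrite ltr_wpDl// !mulr_ge0 ?addr_ge0// exprn_ge0.
move=> s; apply: (@le_trans _ _ (2 ^+ n * (2 * (M0 + M)))); last by rewrite lerDl.
have [a0 b0] := HM0 s; have [a1 b1] := HM s; rewrite !expr0 !mul1r in a0 b0.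
have jn : japanese s `^ r <= 2 ^+ n * (1 + `|s| ^+ n).
  apply: (@le_trans _ _ (japanese s ^+ n)).
    by rewrite -powR_mulrn ?(ltW (japanese_gt0 _))// ler_powR// japanese_ge1.
  have [s1|s1] := leP `|s| 1.
    apply: (@le_trans _ _ (2 ^+ n)); last by rewrite ler_peMr ?exprn_ge0// lerDl exprn_ge0.
    rewrite lerXn2r ?nnegrE ?(ltW (japanese_gt0 _))//.
    by apply: (le_trans (japanese_le s)); lra.
  apply: (@le_trans _ _ ((2 * `|s|) ^+ n)).
    rewrite lerXn2r ?nnegrE ?(ltW (japanese_gt0 _)) ?mulr_ge0//.
    by apply: (le_trans (japanese_le s)); lra.
  by rewrite exprMn ler_pM2l ?exprn_gt0// lerDr.
apply: (le_trans (ler_wpM2r (amplitude_ge0 h s) jn)).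
rewrite -mulrA ler_pM2l ?exprn_gt0//.
have sn0 : 0 <= `|s| ^+ n by rewrite exprn_ge0.
apply: (le_trans (ler_wpM2l _ (amplitude_le h s))); first by rewrite addr_ge0.
rewrite mulrDl mul1r mulrDr; lra.
Qed.

Lemma cos1_le_cos (y : R) : `|y| <= 1 -> cos 1 <= cos y.
Proof.
move=> y1; rewrite -(cos_norm y).
have pi1 : 1 <= pi :> R by apply: le_trans (@pi_ge2 R); lra.
move: y1; rewrite le_eqVlt => /predU1P[->//|y1].
by rewrite ltW// ltr_cos ?in_itv/= ?normr_ge0 ?(le_trans (ltW y1))//; lra.
Qed.

(** On the support of h the phase s t stays in [-1,1], where the cosine is at
    least cos 1 > 0: a nonnegative h admits no cancellation. *)
Lemma amplitude_lower h s : continuous h -> supported01 h -> (forall t, 0 <= h t) ->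
  `|s| <= 1 -> cos 1 * fcos h 0 <= amplitude h s.
Proof.
move=> ch h0 hge s1.
apply: (@le_trans _ _ (fcos h s)); last first.
  rewrite (le_trans (ler_norm _))// -sqrtr_sqr ler_wsqrtr// lerDl sqr_ge0//.
have ich (a : R) : mu.-integrable `[-1, 2] (EFin \o (fun t => h t * cos (a * t))).
  by apply: integrable_itv => x; apply: cvgM; [exact: ch|exact: continuous_cosM].
rewrite /fcos -RintegralZl//; apply: le_Rintegral => //.
  apply: integrable_itv => x; apply: cvgM; [exact: cvg_cst|].
  by apply: cvgM; [exact: ch|exact: continuous_cosM].
move=> t _; rewrite mul0r cos0 mulr1 mulrC.
have [t01|t01] := boolP (0 <= t <= 1); last by rewrite h0// !mul0r.
rewrite ler_wpM2l// cos1_le_cos// normrM mulr_ile1//.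
by case/andP: t01 => t0 t1; rewrite ger0_norm.
Qed.

(** h has a positive minimum on [1/4, 3/4]. *)
Lemma fcos0_gt0 h : continuous h -> (forall t, 0 <= h t) ->
  (forall t : R, 0 < t < 1 -> 0 < h t) -> 0 < fcos h 0.
Proof.
move=> ch hge hgt; rewrite /fcos; under eq_Rintegral do rewrite mul0r cos0 mulr1.
have lt13 : 4^-1 <= 3 / 4 :> R by lra.
have [c cI cmin] := EVT_min lt13 (continuous_subspaceT ch).
have d0 : 0 < h c by move: cI; rewrite in_itv/= => /andP[? ?]; apply: hgt; apply/andP; split; lra.
rewrite -lte_fin /Rintegral fineK; last first.
  by apply: integrable_fin_num => //; exact: integrable_itv.
pose J : set R := `[4^-1, 3 / 4]%classic.
have sJ : J `<=` (`[-1, 2]%classic : set R).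
  by move=> x; rewrite /J /= !in_itv/= => /andP[? ?]; apply/andP; split; lra.
have mJ : measurable J by exact: measurable_itv.
have muJ : mu J = (2^-1)%:E.
  by rewrite [LHS]lebesgue_measure_itv/= lte_fin ifT -?EFinB; [congr EFin|]; lra.
apply: (@lt_le_trans _ _ (h c * 2^-1)%:E); first by rewrite lte_fin mulr_gt0.
apply: (@le_trans _ _ (\int[mu]_(t in J) (h t)%:E)%E).
  apply: (@le_trans _ _ (\int[mu]_(t in J) (h c)%:E)%E).
    by rewrite integral_cst// EFinM -muJ.
  apply: ge0_le_integral => //=.
  - by move=> x _; rewrite lee_fin ltW.
  - by apply/measurable_EFinP/measurable_funTS; exact: continuous_measurable_fun.
apply: ge0_subset_integral => //=.
- by apply/measurable_EFinP/measurable_funTS; exact: continuous_measurable_fun.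
- by move=> x _; rewrite lee_fin.
Qed.

End Decay.

(** * Norms of a single mode *)

Section Norms.
Context {R : realType}.
Implicit Types (h g : R -> R) (k : int).
Local Notation mu := (@lebesgue_measure R).

(** The integral of a nonnegative function is a supremum over the simple
    functions below it, so monotonicity needs no measurability; this spares
    the measurability of the Fourier transforms. *)
Lemma le_nnintegral (f g : R -> \bar R) : (forall x, 0 <= f x)%E ->
  (forall x, f x <= g x)%E -> (\int[mu]_x f x <= \int[mu]_x g x)%E.
Proof.
move=> f0 fg; have g0 x : (0 <= g x)%E by exact: le_trans (fg x).
rewrite !ge0_integralTE//; apply: le_ereal_sup => _ [h hf <-].
by exists h => // x; exact: le_trans (fg x).
Qed.

Lemma L2l2_norm_single (F : int -> R -> R) k0 g : (forall t, 0 <= g t) ->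
  (forall k t, F k t = (k == k0)%:R * g t) ->
  L2l2_norm F = ((\int[mu]_t (g t ^+ 2)%:E) `^ 2^-1)%E.
Proof.
move=> g0 FE; rewrite /L2l2_norm unlock; congr (_ `^ _)%E.
apply: eq_integral => t _.
have -> : esum [set: int] (fun k => (`|F k t| ^+ 2)%:E) = (g t ^+ 2)%:E.
  have := @esum_set1 R int k0 (fun k => (`|F k t| ^+ 2)%:E).
  rewrite esum_mkcond FE eqxx mul1r ger0_norm// => <-; last by rewrite lee_fin sqr_ge0.
  apply: eq_esum => k _; case: ifPn => //.
  by rewrite notin_setE/= => /eqP/negbTE kk; rewrite FE kk mul0r normr0 expr0n.
rewrite poweR_EFin powR12_sqrt ?sqr_ge0// sqrtr_sqr ger0_norm//.
by rewrite ger0_norm// powR_mulrn.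
Qed.

(** The value at t0 = 0 is twice the limit of the arctangent; the general case
    is a translation. *)
Lemma integral_oneDsqr_shift (t0 : R) :
  (\int[mu]_t ((1 + (t0 - t) ^+ 2)^-1)%:E = pi%:E)%E.
Proof.
have dF (x : R) : is_derive x 1 (fun t => t - t0) 1.
  by apply: (is_derive_eq (is_deriveB (is_derive_id x 1) (is_derive_cst t0 x 1))); rewrite subr0.
have dF1 := is_derive_derive1 dF.
have G0 (x : R) : 0 <= (oneDsqr x)^-1 by rewrite invr_ge0 addr_ge0 ?sqr_ge0.
have cG := @continuous_oneDsqrV R.
have := @increasing_ge0_integration_by_substitutionT R (fun t => t - t0) (fun x => (oneDsqr x)^-1).
rewrite dF1 => H.
transitivity (\int[mu]_x ((oneDsqr x)^-1)%:E)%E.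
  rewrite H//.
  - apply: eq_integral => t _.
    by rewrite /GRing.mul/= mulr1 /oneDsqr -(sqrrN (t0 - t)) opprB.
  - by move=> x y; rewrite ltrD2r.
  - by move=> x; exact: cvg_cst.
  - exact: is_cvg_cst.
  - exact: is_cvg_cst.
  - apply/cvgrNyPle => A; near=> x.
    by rewrite lerBlDr; near: x; exact: (nbhs_ninfty_le (num_real _)).
  - apply/cvgryPge => A; near=> x.
    by rewrite lerBrDr; near: x; exact: (nbhs_pinfty_ge (num_real _)).
rewrite ge0_symfun_integralT//.
  rewrite -[X in _ _ X _]set_itvcy integral0y_oneDsqr -EFinM; congr EFin.
  by rewrite mulrC divfK.
by move=> x; rewrite /= /oneDsqr sqrrN.
Unshelve. all: by end_near. Qed.

Lemma japanese_le_mul (x y d : R) : `|x - y| <= `|d| ->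
  japanese x <= 2 * (japanese y * japanese d).
Proof.
move=> xyd.
have j0 := fun z => ltW (@japanese_gt0 R z).
rewrite -(@ler_pXn2r _ 2) ?nnegrE ?j0 ?mulr_ge0 ?j0// !exprMn !sqr_japanese.
have xd : (x - y) ^+ 2 <= d ^+ 2 by rewrite -[_ ^+ 2]real_normK ?num_real// -[d ^+ 2]real_normK ?num_real// lerXn2r ?nnegrE.
have := sqr_ge0 (x - 2 * y); have := sqr_ge0 y; have := sqr_ge0 d; have := sqr_ge0 (y * d).
nra.
Qed.

(** Peetre's inequality: weights of any exponent b, positive or negative, are
    slowly varying. *)
Lemma peetre (x y d b : R) : `|x - y| <= `|d| ->
  japanese x `^ b <= 2 `^ `|b| * japanese y `^ b * japanese d `^ `|b|.
Proof.
move=> xyd; have j0 := fun z => ltW (@japanese_gt0 R z).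
have jb z c : 0 < japanese z `^ c :> R by rewrite powR_gt0 ?japanese_gt0.
have [b0|b0] := leP 0 b.
  rewrite ger0_norm// -mulrA -!powRM ?mulr_ge0 ?j0// ge0_ler_powR ?nnegrE ?mulr_ge0 ?j0//.
  exact: japanese_le_mul.
(* For a negative exponent, exchange x and y. *)
have [c c0 ->] : exists2 c, 0 <= c & b = - c.
  by exists (- b); rewrite ?opprK// oppr_ge0 ltW.
rewrite normrN (ger0_norm c0) !powRN.
rewrite mulrAC ler_pdivlMr// mulrC ler_pdivrMr// -mulrA -!powRM ?mulr_ge0 ?j0//.
rewrite ge0_ler_powR ?nnegrE ?mulr_ge0 ?j0//.
by rewrite (mulrC (japanese d)) japanese_le_mul// distrC.
Qed.

(** Both norms are instances, for the two modulations m. *)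
Definition mod_norm (m : int -> R -> R) (s b : R) (f : R * R -> R[i]) : \bar R :=
  L2l2_norm (fun k tau => japanese k%:~R `^ s * japanese (m k tau) `^ b *
    ComplexField.Normc.normc (spacetime_fourier f k tau)).

Lemma mod_norm_mode m s b k0 tau0 h : continuous h -> supported01 h ->
  mod_norm m s b (mode k0 tau0 h) = ((\int[mu]_t
    ((japanese k0%:~R `^ s * japanese (m k0 t) `^ b *
      ((pi *+ 2)^-1 * amplitude h (tau0 - t))) ^+ 2)%:E) `^ 2^-1)%E.
Proof.
move=> ch h0; apply: (@L2l2_norm_single _ k0) => [t|k t].
  by rewrite !mulr_ge0 ?powR_ge0 ?amplitude_ge0// invr_ge0 mulrn_wge0// pi_ge0.
rewrite normc_spacetime_fourier_mode//; case: eqP => [->|_].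
  by rewrite !mul1r.
by rewrite !mul0r mulr0.
Qed.

End Norms.

Section NormBounds.
Context {R : realType}.
Implicit Types (h g : R -> R) (k : int).
Local Notation mu := (@lebesgue_measure R).

Definition lip_modulation (m : int -> R -> R) :=
  forall k t t', `|m k t - m k t'| <= `|t - t'|.

Lemma le_poweR_half (x y : \bar R) : (0 <= x)%E -> (x <= y)%E -> (x `^ 2^-1 <= y `^ 2^-1)%E.
Proof.
move=> x0 xy; apply: gt0_ler_poweR => //; rewrite in_itv/= ?leey ?andbT//.
exact: le_trans xy.
Qed.

Lemma poweR_half_sqr (a : R) : 0 <= a -> ((a ^+ 2)%:E `^ 2^-1)%E = a%:E.
Proof. by move=> a0; rewrite poweR_EFin powR12_sqrt ?sqr_ge0// sqrtr_sqr ger0_norm. Qed.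

(** By Peetre's inequality the weight at t is the weight at the centre tau0 up
    to <tau0 - t>^|b|; the decay of the amplitude absorbs this factor and
    leaves <tau0 - t>^(-1), which is square integrable. *)
Lemma mod_norm_upper m s b h : lip_modulation m -> (forall n, smooth1 n h) ->
  supported01 h -> exists2 K, 0 < K & forall k0 tau0,
  (mod_norm m s b (mode k0 tau0 h) <=
    (K * (japanese k0%:~R `^ s * japanese (m k0 tau0) `^ b))%:E)%E.
Proof.
move=> lm sh h0; have ch := smooth1_continuous (sh 0%N).
have [K K0 HK] := amplitude_decay (`|b| + 1) sh h0.
have pi0 : 0 < pi :> R := pi_gt0 R.
have c20 : 0 < 2 `^ `|b| :> R by rewrite powR_gt0.
pose D := 2 `^ `|b| * (pi *+ 2)^-1 * K.
have D0 : 0 < D by rewrite !mulr_gt0// invr_gt0 mulrn_wgt0.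
exists (D * Num.sqrt pi); first by rewrite mulr_gt0// sqrtr_gt0.
move=> k0 tau0; rewrite mod_norm_mode//.
set w := japanese k0%:~R `^ s; set wb := japanese (m k0 tau0) `^ b.
have w0 : 0 <= w by exact: powR_ge0.
have wb0 : 0 <= wb by exact: powR_ge0.
pose E := D * (w * wb).
have E0 : 0 <= E by apply: mulr_ge0; [exact: ltW|exact: mulr_ge0].
have B (t : R) : (w * japanese (m k0 t) `^ b * ((pi *+ 2)^-1 * amplitude h (tau0 - t))) ^+ 2
    <= E ^+ 2 * (1 + (tau0 - t) ^+ 2)^-1.
  rewrite -sqr_japanese -exprVn -exprMn lerXn2r ?nnegrE//.
  - by rewrite !mulr_ge0 ?powR_ge0 ?amplitude_ge0// invr_ge0 mulrn_wge0// ltW.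
  - by rewrite mulr_ge0// invr_ge0 ltW// japanese_gt0.
  have jd := japanese_gt0 (tau0 - t).
  rewrite ler_pdivlMr//.
  have P : japanese (m k0 t) `^ b <= 2 `^ `|b| * wb * japanese (tau0 - t) `^ `|b|.
    by apply: peetre; rewrite -(normrN (tau0 - t)) opprB.
  have H1 : japanese (m k0 t) `^ b * (amplitude h (tau0 - t) * japanese (tau0 - t)) <=
      2 `^ `|b| * wb * K.
    apply: (le_trans (ler_wpM2r _ P)); first by rewrite mulr_ge0 ?amplitude_ge0// ltW.
    have := HK (tau0 - t); rewrite powRD; last by rewrite gt_eqF// implybT.
    rewrite powRr1 ?(ltW jd)// => HK'.
    have -> : 2 `^ `|b| * wb * japanese (tau0 - t) `^ `|b| *
        (amplitude h (tau0 - t) * japanese (tau0 - t)) = (2 `^ `|b| * wb) *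
        (japanese (tau0 - t) `^ `|b| * japanese (tau0 - t) * amplitude h (tau0 - t)) by ring.
    by rewrite ler_wpM2l// mulr_ge0// ltW.
  have -> : w * japanese (m k0 t) `^ b * ((pi *+ 2)^-1 * amplitude h (tau0 - t)) * japanese (tau0 - t)
     = (w * (pi *+ 2)^-1) * (japanese (m k0 t) `^ b * (amplitude h (tau0 - t) * japanese (tau0 - t))).
    by rewrite !mulrA (mulrAC w (japanese _ `^ _)).
  have -> : E = w * (pi *+ 2)^-1 * (2 `^ `|b| * wb * K) by rewrite /E /D; ring.
  by rewrite ler_wpM2l// mulr_ge0// invr_ge0 mulrn_wge0// ltW.
have I0 : (0 <= \int[mu]_t ((w * japanese (m k0 t) `^ b *
      ((pi *+ 2)^-1 * amplitude h (tau0 - t))) ^+ 2)%:E)%E.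
  by apply: integral_ge0 => t _; rewrite lee_fin sqr_ge0.
apply: (le_trans (le_poweR_half (y := ((E * Num.sqrt pi) ^+ 2)%:E) I0 _)); last first.
  have ES0 : 0 <= E * Num.sqrt pi by apply: mulr_ge0 => //; exact: sqrtr_ge0.
  by rewrite poweR_half_sqr// lee_fin /E mulrAC.
rewrite exprMn sqr_sqrtr ?(ltW pi0)// EFinM -(integral_oneDsqr_shift tau0).
have V0 (t : R) : 0 <= (1 + (tau0 - t) ^+ 2)^-1 by rewrite invr_ge0 addr_ge0 ?sqr_ge0.
rewrite -ge0_integralZl//; first 1 last.
- apply/measurable_EFinP; apply: continuous_measurable_fun => t.
  apply: (@continuous_comp _ _ _ (fun t => tau0 - t) (fun x => (oneDsqr x)^-1) t).
    by apply: cvgB; [exact: cvg_cst|exact: cvg_id].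
  exact: continuous_oneDsqrV.
- by move=> t _; rewrite lee_fin.
- by rewrite lee_fin sqr_ge0.
apply: le_nnintegral => t; first by rewrite lee_fin sqr_ge0.
by rewrite -EFinM lee_fin B.
Qed.

(** On the window |t - tau0| <= 1 the weight is comparable to its value at the
    centre and the amplitude is bounded below by a multiple of the integral of
    the envelope.  The constant depends on b alone, so that an envelope may
    carry a factor depending on k. *)
Lemma mod_norm_lower b : exists2 c : R, 0 < c & forall m s h k0 tau0,
  lip_modulation m -> continuous h -> supported01 h -> (forall t, 0 <= h t) ->
  ((c * fcos h 0 * (japanese k0%:~R `^ s * japanese (m k0 tau0) `^ b))%:E <=
   mod_norm m s b (mode k0 tau0 h))%E.
Proof.
have pi0 : 0 < pi :> R := pi_gt0 R.
pose q : R := 2 `^ `|b| * 2 `^ `|b|.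
have q0 : 0 < q by rewrite mulr_gt0// powR_gt0.
pose c := q^-1 * ((pi *+ 2)^-1 * cos 1).
have c1 : 0 < cos 1 :> R := cos1_gt0 R.
have p0 : 0 < (pi *+ 2)^-1 :> R by rewrite invr_gt0 mulrn_wgt0.
have c0 : 0 < c by apply: mulr_gt0; [rewrite invr_gt0|exact: mulr_gt0].
exists c => // m s h k0 tau0 lm ch h0 hge; rewrite mod_norm_mode//.
set w := japanese k0%:~R `^ s; set wb := japanese (m k0 tau0) `^ b.
have w0 : 0 <= w by exact: powR_ge0.
have wb0 : 0 <= wb by exact: powR_ge0.
have f0 : 0 <= fcos h 0.
  by apply: Rintegral_ge0 => t _; rewrite mul0r cos0 mulr1.
set e := c * _ * _.
have e0 : 0 <= e.
  by apply: mulr_ge0; [apply: mulr_ge0 => //; exact: ltW|exact: mulr_ge0].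
have B (t : R) : `|tau0 - t| <= 1 ->
    e <= w * japanese (m k0 t) `^ b * ((pi *+ 2)^-1 * amplitude h (tau0 - t)).
  move=> t1.
  have P : wb <= q * japanese (m k0 t) `^ b.
    apply: (le_trans (@peetre _ _ (m k0 t) (tau0 - t) b _)) => //.
    rewrite mulrAC ler_wpM2r ?powR_ge0// ler_wpM2l ?powR_ge0//.
    rewrite ge0_ler_powR ?nnegrE// ?(ltW (japanese_gt0 _))//.
    by apply: (le_trans (japanese_le _)); lra.
  have -> : e = w * (q^-1 * wb) * ((pi *+ 2)^-1 * (cos 1 * fcos h 0)) by rewrite /e /c; ring.
  apply: ler_pM.
  - by apply: mulr_ge0 => //; apply: mulr_ge0 => //; rewrite invr_ge0 ltW.
  - by apply: mulr_ge0; [exact: ltW|apply: mulr_ge0 => //; exact: ltW].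
  - by rewrite ler_wpM2l// mulrC ler_pdivrMr// mulrC.
  - by rewrite ler_wpM2l ?(ltW p0)// amplitude_lower.
pose J : set R := `[tau0 - 1, tau0 + 1]%classic.
have mJ : measurable J by exact: measurable_itv.
have muJ : mu J = 2%:E.
  by rewrite [LHS]lebesgue_measure_itv/= lte_fin ifT -?EFinB; [congr EFin|]; lra.
apply: (@le_trans _ _ ((e ^+ 2)%:E `^ 2^-1)%E); first by rewrite poweR_half_sqr.
apply: le_poweR_half; first by rewrite lee_fin sqr_ge0.
apply: (@le_trans _ _ (\int[mu]_(t in J) (e ^+ 2)%:E)%E).
  rewrite integral_cst// [X in (_ <= _ * X)%E]muJ -EFinM lee_fin.
  by rewrite ler_peMr ?sqr_ge0//; lra.
rewrite integral_mkcond; apply: le_nnintegral => t.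
  by rewrite patchE; case: ifP => // _; rewrite lee_fin sqr_ge0.
rewrite patchE; case: ifPn => [|_]; last by rewrite lee_fin sqr_ge0.
rewrite inE /J /= in_itv/= => /andP[a1 a2].
have t1 : `|tau0 - t| <= 1 by rewrite ler_norml; apply/andP; split; lra.
by rewrite lee_fin lerXn2r ?nnegrE ?(le_trans e0 (B _ t1))// B.
Qed.

Lemma fcosZ h (a s : R) : continuous h -> fcos (fun t => a * h t) s = a * fcos h s.
Proof.
move=> ch; rewrite /fcos -RintegralZl//.
  by apply: eq_Rintegral => t _; rewrite mulrA.
by apply: integrable_itv => x; apply: cvgM; [exact: ch|exact: continuous_cosM].
Qed.

End NormBounds.

(** * Orders of growth *)

Section Growth.
Context {R : realType}.
Implicit Types (u v : nat -> R) (e f : R).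

Definition grows u e := exists c d : R, [/\ 0 < c, 0 < d &
  \forall N \near \oo, c * N%:R `^ e <= u N <= d * N%:R `^ e].

Lemma eq_grows u v e : u =1 v -> grows u e -> grows v e.
Proof. by move=> /funext ->. Qed.

Lemma grows_cst (a : R) : 0 < a -> grows (fun=> a) 0.
Proof.
by move=> a0; exists a, a; split => //; near=> N; rewrite powRr0 mulr1 lexx.
Unshelve. all: by end_near. Qed.

Lemma grows_natr (a : R) : 0 < a -> grows (fun N => a * N%:R) 1.
Proof.
by move=> a0; exists a, a; split => //; near=> N; rewrite powRr1// lexx.
Unshelve. all: by end_near. Qed.

Lemma grows_mul u v e f : grows u e -> grows v f -> grows (fun N => u N * v N) (e + f).
Proof.
move=> [c [d [c0 d0 H]]] [c' [d' [c0' d0' H']]].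
exists (c * c'), (d * d'); split; [exact: mulr_gt0|exact: mulr_gt0|].
near=> N.
have N0 : 0 < N%:R :> R by rewrite ltr0n; near: N; exact: nbhs_infty_gt.
rewrite powRD; last by rewrite (gt_eqF N0) implybT.
have /andP[h1 h2] : c * N%:R `^ e <= u N <= d * N%:R `^ e by near: N.
have /andP[h3 h4] : c' * N%:R `^ f <= v N <= d' * N%:R `^ f by near: N.
have p1 : 0 <= c * N%:R `^ e by rewrite mulr_ge0 ?powR_ge0// ltW.
have p2 : 0 <= c' * N%:R `^ f by rewrite mulr_ge0 ?powR_ge0// ltW.
by rewrite mulrACA [d * d' * _]mulrACA !ler_pM// ?(le_trans p1 h1) ?(le_trans p2 h3).
Unshelve. all: by end_near. Qed.

(** A negative power exchanges the two bounds. *)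
Lemma grows_powR u e (r : R) : grows u e -> grows (fun N => u N `^ r) (e * r).
Proof.
move=> [c [d [c0 d0 H]]].
have pw (a : R) : 0 < a -> 0 < a `^ r by move=> a0; rewrite powR_gt0.
have [r0|r0] := leP 0 r.
  exists (c `^ r), (d `^ r); split; [exact: pw|exact: pw|].
  near=> N.
  have N0 : 0 < N%:R :> R by rewrite ltr0n; near: N; exact: nbhs_infty_gt.
  have Ne : 0 < N%:R `^ e :> R by rewrite powR_gt0.
  have /andP[h1 h2] : c * N%:R `^ e <= u N <= d * N%:R `^ e by near: N.
  have cN : 0 < c * N%:R `^ e by rewrite mulr_gt0.
  rewrite powRrM -!powRM ?(ltW c0) ?(ltW d0) ?(ltW Ne)//.
  by rewrite !ge0_ler_powR ?nnegrE ?(ltW cN) ?(le_trans _ h1)// ?(le_trans _ h2) ?(le_trans _ h1) ?(ltW cN).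
exists (d `^ r), (c `^ r); split; [exact: pw|exact: pw|].
near=> N.
have N0 : 0 < N%:R :> R by rewrite ltr0n; near: N; exact: nbhs_infty_gt.
have Ne : 0 < N%:R `^ e :> R by rewrite powR_gt0.
have /andP[h1 h2] : c * N%:R `^ e <= u N <= d * N%:R `^ e by near: N.
have cN : 0 < c * N%:R `^ e by rewrite mulr_gt0.
have uN : 0 < u N by exact: lt_le_trans h1.
have dN : 0 < d * N%:R `^ e by rewrite mulr_gt0.
rewrite powRrM -!powRM ?(ltW c0) ?(ltW d0) ?(ltW Ne)//.
have [q q0 ->] : exists2 q : R, 0 <= q & r = - q.
  by exists (- r); rewrite ?opprK// oppr_ge0 ltW.
by rewrite !powRN !lef_pV2 ?posrE ?powR_gt0// !ge0_ler_powR ?nnegrE ?(ltW cN) ?(ltW uN) ?(ltW dN).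
Unshelve. all: by end_near. Qed.

Lemma near_powR_ge e (A : R) : 0 < e -> \forall N \near \oo, A <= N%:R `^ e.
Proof.
move=> e0; near=> N.
have [A0|A0] := leP A 0; first exact: le_trans (powR_ge0 _ _).
have -> : A = (A `^ e^-1) `^ e by rewrite -powRrM mulVf ?gt_eqF// powRr1// ltW.
rewrite ge0_ler_powR ?nnegrE ?(ltW e0) ?powR_ge0//.
by near: N; exact: nbhs_infty_ger.
Unshelve. all: by end_near. Qed.

(** If f < e, then N^(e - f) would be bounded. *)
Lemma grows_le u v e f (K : R) : grows u e -> grows v f -> (forall N, u N <= K * v N) ->
  e <= f.
Proof.
move=> [c [d [c0 d0 H]]] [c' [d' [c0' d0' H']]] uv; rewrite leNgt; apply/negP => fe.
have {}fe : 0 < e - f by rewrite subr_gt0.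
have [N] : exists N : nat, [/\ c * N%:R `^ e <= u N <= d * N%:R `^ e,
    c' * N%:R `^ f <= v N <= d' * N%:R `^ f, (0 < N)%N &
    `|K| * d' / c + 1 <= N%:R `^ (e - f)].
  apply: (@filter_ex _ (\oo : set_system nat)); near=> N; split.
  - by near: N.
  - by near: N.
  - by near: N; exact: nbhs_infty_gt.
  - by near: N; exact: near_powR_ge.
move=> [/andP[h1 _] /andP[h3 h4] N0]; rewrite leNgt => /negP; apply.
have NR : 0 < N%:R :> R by rewrite ltr0n.
have Nf : 0 < N%:R `^ f :> R by rewrite powR_gt0.
have v0 : 0 <= v N by apply: le_trans h3; rewrite mulr_ge0 ?(ltW c0')// ltW.
have E : N%:R `^ e = N%:R `^ (e - f) * N%:R `^ f :> R.
  by rewrite -powRD ?subrK// (gt_eqF NR) implybT.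
apply: (@le_lt_trans _ _ (`|K| * d' / c)); last by rewrite ltrDl.
rewrite ler_pdivlMr// -(ler_pM2r Nf) -[leLHS]mulrA [leLHS]mulrCA -E.
rewrite (le_trans h1)// (le_trans (uv N))// -mulrA.
by apply: (le_trans (ler_wpM2r v0 (ler_norm K))); rewrite ler_wpM2l.
Unshelve. all: by end_near. Qed.

Lemma grows_add u v e f : f <= e -> grows u e -> grows v f -> (forall N, 0 <= v N) ->
  grows (fun N => u N + v N) e.
Proof.
move=> fe [c [d [c0 d0 H]]] [c' [d' [c0' d0' H']]] v0.
exists c, (d + d'); split => //; first exact: addr_gt0.
near=> N.
have /andP[h1 h2] : c * N%:R `^ e <= u N <= d * N%:R `^ e by near: N.
have /andP[h3 h4] : c' * N%:R `^ f <= v N <= d' * N%:R `^ f by near: N.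
have N1 : 1 <= N%:R :> R by rewrite ler1n; near: N; exact: nbhs_infty_gt.
rewrite (le_trans h1) ?lerDl//= mulrDl lerD// (le_trans h4)// ler_wpM2l ?(ltW d0')//.
exact: ler_powR.
Unshelve. all: by end_near. Qed.

(** The term of lower order cannot cancel more than half of the leading one. *)
Lemma grows_dist u v e f : f < e -> grows u e -> grows v f -> (forall N, 0 <= v N) ->
  grows (fun N => `|u N - v N|) e.
Proof.
move=> fe [c [d [c0 d0 H]]] [c' [d' [c0' d0' H']]] v0.
exists (c / 2), (d + d'); split => //; [by rewrite divr_gt0|exact: addr_gt0|].
have {}fe' : 0 < e - f by rewrite subr_gt0.
near=> N.
have /andP[h1 h2] : c * N%:R `^ e <= u N <= d * N%:R `^ e by near: N.
have /andP[h3 h4] : c' * N%:R `^ f <= v N <= d' * N%:R `^ f by near: N.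
have N1 : 1 <= N%:R :> R by rewrite ler1n; near: N; exact: nbhs_infty_gt.
have N0 : 0 < N%:R :> R by exact: lt_le_trans N1.
have Nf : 0 < N%:R `^ f :> R by rewrite powR_gt0.
have Ne : 0 < N%:R `^ e :> R by rewrite powR_gt0.
have hD : 2 * d' / c <= N%:R `^ (e - f) by near: N; exact: near_powR_ge.
have E : N%:R `^ e = N%:R `^ (e - f) * N%:R `^ f :> R.
  by rewrite -powRD ?subrK// (gt_eqF N0) implybT.
have h5 : 2 * (d' * N%:R `^ f) <= c * N%:R `^ e.
  by rewrite E mulrA [leRHS]mulrA ler_pM2r// [leRHS]mulrC -ler_pdivrMr.
have h6 : N%:R `^ f <= N%:R `^ e :> R by apply: ler_powR => //; exact: ltW.
have h7 : d' * N%:R `^ f <= d' * N%:R `^ e by rewrite ler_pM2l.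
have h8 := v0 N; have h9 : 0 <= d' * N%:R `^ e by rewrite mulr_ge0// ltW.
have h10 : 0 < c * N%:R `^ e by rewrite mulr_gt0.
have -> : c / 2 * N%:R `^ e = (c * N%:R `^ e) / 2 by rewrite mulrAC.
rewrite mulrDl; apply/andP; split.
  by apply: le_trans (ler_norm _); lra.
by rewrite ler_norml; apply/andP; split; lra.
Unshelve. all: by end_near. Qed.

Lemma grows_japanese u e : 0 <= e -> grows (fun N => `|u N|) e -> grows (fun N => japanese (u N)) e.
Proof.
move=> e0 [c [d [c0 d0 H]]]; exists c, (1 + d); split => //; first exact: addr_gt0.
near=> N.
have /andP[h1 h2] : c * N%:R `^ e <= `|u N| <= d * N%:R `^ e by near: N.
have N1 : 1 <= N%:R :> R by rewrite ler1n; near: N; exact: nbhs_infty_gt.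
rewrite (le_trans h1) ?normr_le_japanese//= (le_trans (japanese_le _))// mulrDl mul1r lerD//.
by rewrite -[leLHS](powRr0 N%:R) ler_powR.
Unshelve. all: by end_near. Qed.

Lemma grows_japanese0 u : (forall N, u N = 0) -> grows (fun N => japanese (u N)) 0.
Proof.
move=> u0; apply: (@eq_grows (fun=> japanese 0)); first by move=> N; rewrite u0.
by apply: grows_cst; exact: japanese_gt0.
Qed.

Definition weight (s b x y : R) := japanese x `^ s * japanese y `^ b.

Lemma grows_weight (x y : nat -> R) (a e s b : R) :
  grows (fun N => japanese (x N)) a -> grows (fun N => japanese (y N)) e ->
  grows (fun N => weight s b (x N) (y N)) (a * s + e * b).
Proof. by move=> gx gy; apply: grows_mul; exact: grows_powR. Qed.

Variables (alpha beta eps : R).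
Hypotheses (halpha : 0 < alpha) (hbeta : 0 < beta) (heps : 0 < eps).

Definition phaseS (x : R) := alpha * x ^+ 2 + eps ^+ 2 * x ^+ 4.
Definition phaseW (x : R) := beta * `|x| * japanese (eps * x).

Lemma phaseW_ge0 x : 0 <= phaseW x.
Proof. by rewrite /phaseW !mulr_ge0 ?(ltW hbeta)// ltW// japanese_gt0. Qed.

Lemma grows_phaseW (a : R) : 0 < a -> grows (fun N => phaseW (a * N%:R)) 2.
Proof.
move=> a0.
apply: (@eq_grows (fun N => (beta * a * N%:R) * japanese (eps * a * N%:R))).
  by move=> N; rewrite /phaseW ger0_norm ?mulr_ge0// ?(ltW a0)// !mulrA.
have -> : 2 = 1 + 1 :> R by lra.
apply: grows_mul; first by apply: grows_natr; exact: mulr_gt0.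
apply: grows_japanese => //.
apply: (@eq_grows (fun N => eps * a * N%:R)).
  by move=> N; rewrite ger0_norm// !mulr_ge0// ltW.
by apply: grows_natr; exact: mulr_gt0.
Qed.

Lemma grows_phaseS : grows (fun N => phaseS N%:R) 4.
Proof.
have gX n : grows (fun N => N%:R ^+ n) n%:R.
  exists 1, 1; split => //; near=> N.
  by rewrite powR_mulrn// mul1r lexx.
apply: (@eq_grows (fun N => eps ^+ 2 * N%:R ^+ 4 + alpha * N%:R ^+ 2)).
  by move=> N; rewrite /phaseS addrC.
apply: (@grows_add _ _ _ 2).
- lra.
- rewrite -[4]add0r; apply: grows_mul; last exact: (gX 4%N).
  by apply: grows_cst; rewrite exprn_gt0.
- by rewrite -[2]add0r; apply: grows_mul; [exact: grows_cst|exact: (gX 2%N)].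
- by move=> N; rewrite mulr_ge0 ?exprn_ge0// ltW.
Unshelve. all: by end_near. Qed.

Lemma phaseS_ge0 (x : R) : 0 <= phaseS x.
Proof. by rewrite addr_ge0// mulr_ge0 ?sqr_ge0 ?(ltW halpha)// -[4%N]/(2 * 2)%N exprM sqr_ge0. Qed.

End Growth.

(** * From a bilinear estimate to an inequality between weights *)

Section Key.
Context {R : realType}.
Variables (alpha beta eps : R).
Implicit Types (s l b rho tau : R) (k : int).

Definition modS k (tau : R) : R := tau + alpha * k%:~R ^+ 2 + eps ^+ 2 * k%:~R ^+ 4.
Definition modW k (tau : R) : R := `|tau| - beta * `|k%:~R| * japanese (eps * k%:~R).

Lemma lip_modS : lip_modulation modS.
Proof. by move=> k t t'; rewrite /modS (_ : _ - _ = t - t')//; ring. Qed.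

Lemma lip_modW : lip_modulation modW.
Proof.
move=> k t t'; rewrite /modW opprB addrA subrK; exact: ler_dist_dist.
Qed.

Lemma modSE k tau : modS k tau = tau + phaseS alpha eps k%:~R.
Proof. by rewrite /modS /phaseS addrA. Qed.

Lemma modWE k tau : modW k tau = `|tau| - phaseW beta eps k%:~R.
Proof. by []. Qed.

Lemma mod_norm_ge0 (m : int -> R -> R) s b f : (0 <= mod_norm m s b f)%E.
Proof. exact: Lnorm_ge0. Qed.

Lemma supported01_bump : supported01 (@bump R).
Proof. by move=> t; exact: bump_out. Qed.

Lemma test_fun_mode_bump k tau : test_fun (mode k tau (@bump R)).
Proof.
apply: (@test_fun_mode _ _ _ _ 1) => [n|t t1]; first exact: smooth1_bump.
apply: supported01_bump; apply: contraL t1 => /andP[t0 t1].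
by rewrite -leNgt ger0_norm.
Qed.

Lemma continuous_bump2 : continuous ((@bump R) \* (@bump R)).
Proof. by apply: (@smooth1_continuous _ 0); apply: smooth1M; exact: smooth1_bump. Qed.

Lemma supported01_bump2 : supported01 ((@bump R) \* (@bump R)).
Proof. by move=> t t01; rewrite /= supported01_bump// mul0r. Qed.

Lemma bump2_ge0 (t : R) : 0 <= ((@bump R) \* (@bump R)) t.
Proof. by rewrite /= mulr_ge0 ?bump_ge0. Qed.

Lemma fcos_bump2_gt0 : 0 < fcos ((@bump R) \* (@bump R)) 0.
Proof.
apply: fcos0_gt0; [exact: continuous_bump2|exact: bump2_ge0|].
by move=> t t01; rewrite /= mulr_gt0 ?bump_gt0.
Qed.

(** The upper bounds on the two factors on the right are finite, so the
    inequality between extended reals descends to one between reals. *)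
Lemma bilinear_fin (X Y Z : \bar R) (c x C K1 y K2 z : R) : 0 < c -> 0 < C ->
  (0 <= Y)%E -> (0 <= Z)%E ->
  ((c * x)%:E <= X)%E -> (Y <= (K1 * y)%:E)%E -> (Z <= (K2 * z)%:E)%E ->
  (X <= C%:E * Y * Z)%E -> x <= C * K1 * K2 / c * (y * z).
Proof.
move=> c0 C0 Y0 Z0 xX Yy Zz XYZ.
have : ((c * x)%:E <= (C * (K1 * y) * (K2 * z))%:E)%E.
  apply: (le_trans xX); apply: (le_trans XYZ).
  rewrite !EFinM; apply: lee_pmul => //; first by rewrite mule_ge0// lee_fin ltW.
  by apply: lee_pmul => //; rewrite ?lee_fin ?(ltW C0).
rewrite lee_fin -ler_pdivlMl// => /le_trans; apply.
by rewrite le_eqVlt; apply/orP; left; apply/eqP; field; rewrite gt_eqF.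
Qed.

(** Tested on u and n equal to modes; their product has the envelope bump^2. *)
Lemma schrodinger_necessary s l b :
  (exists C : R, 0 < C /\
    forall u n : R * R -> R[i], test_fun u -> test_fun n ->
    (XS_norm alpha eps s (b - 1) (fun p => (u p * n p)%R)
     <= C%:E * XS_norm alpha eps s b u * XW_norm beta eps l b n)%E) ->
  exists K : R, forall k1 k2 tau1 tau2,
    weight s (b - 1) (k1 + k2)%:~R (modS (k1 + k2) (tau1 + tau2)) <=
    K * (weight s b k1%:~R (modS k1 tau1) * weight l b k2%:~R (modW k2 tau2)).
Proof.
move=> [C [C0 HC]].
have [c c0 Hc] := @mod_norm_lower R (b - 1).
have [K1 K10 HK1] := mod_norm_upper s b lip_modS smooth1_bump supported01_bump.
have [K2 K20 HK2] := mod_norm_upper l b lip_modW smooth1_bump supported01_bump.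
have I0 := fcos_bump2_gt0.
exists (C * K1 * K2 / (c * fcos ((@bump R) \* (@bump R)) 0)) => k1 k2 tau1 tau2.
have := HC _ _ (test_fun_mode_bump k1 tau1) (test_fun_mode_bump k2 tau2).
rewrite modeM; apply: bilinear_fin.
- exact: mulr_gt0.
- exact: C0.
- exact: (mod_norm_ge0 modS).
- exact: (mod_norm_ge0 modW).
- by apply: (Hc modS) => //; [exact: lip_modS|exact: continuous_bump2|
    exact: supported01_bump2|exact: bump2_ge0].
- exact: HK1.
- exact: HK2.
Qed.

(** The conjugate of the second mode carries the frequencies -k2 and -tau2; the
    factor |k|^rho of D^rho is absorbed in the envelope. *)
Lemma wave_necessary s l b rho :
  (exists C : R, 0 < C /\
    forall u v : R * R -> R[i], test_fun u -> test_fun v ->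
    (XW_norm beta eps l (b - 1) (absD rho (fun p => (u p * (v p)^*%C)%R))
     <= C%:E * XS_norm alpha eps s b u * XS_norm alpha eps s b v)%E) ->
  exists K : R, forall k1 k2 tau1 tau2,
    `|(k1 - k2)%:~R| `^ rho * weight l (b - 1) (k1 - k2)%:~R (modW (k1 - k2) (tau1 - tau2)) <=
    K * (weight s b k1%:~R (modS k1 tau1) * weight s b k2%:~R (modS k2 tau2)).
Proof.
move=> [C [C0 HC]].
have [c c0 Hc] := @mod_norm_lower R (b - 1).
have [K1 K10 HK1] := mod_norm_upper s b lip_modS smooth1_bump supported01_bump.
set h2 := (@bump R) \* (@bump R).
have I0 : 0 < fcos h2 0 := fcos_bump2_gt0.
exists (C * K1 * K1 / (c * fcos h2 0)) => k1 k2 tau1 tau2.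
have := HC _ _ (test_fun_mode_bump k1 tau1) (test_fun_mode_bump k2 tau2).
have -> : (fun p => mode k1 tau1 bump p * ((mode k2 tau2 bump p)^*)%C) =
    mode (k1 - k2) (tau1 - tau2) h2.
  rewrite -modeM; apply/funext => p.
  by have /(congr1 (fun g => g p)) /= -> := mode_conj k2 tau2 (@bump R).
rewrite absD_mode; apply: bilinear_fin.
- exact: (mulr_gt0 c0 I0).
- exact: C0.
- exact: (mod_norm_ge0 modS).
- exact: (mod_norm_ge0 modS).
- set a := `|(k1 - k2)%:~R| `^ rho; set w := weight _ _ _ _.
  have -> : c * fcos h2 0 * (a * w) = c * fcos (fun t => a * h2 t) 0 * w.
    by rewrite fcosZ; [ring|exact: continuous_bump2].
  apply: (Hc modW) => //.
  + exact: lip_modW.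
  + by move=> x; apply: cvgM; [exact: cvg_cst|exact: continuous_bump2].
  + by move=> t t01; rewrite [h2 t]supported01_bump2// mulr0.
  + by move=> t; apply: mulr_ge0; [exact: powR_ge0|exact: bump2_ge0].
- exact: HK1.
- exact: HK1.
Qed.

End Key.

(** * Resonant frequencies and exponents *)

Section Compare.
Context {R : realType}.

(** The exponents of N on the two sides of an inequality between weights are
    ordered; z carries the symbol of D^rho. *)
Lemma weight_compare (K s0 b0 s1 b1 s2 b2 a0 e0 a1 e1 a2 e2 rho r : R)
    (z x0 y0 x1 y1 x2 y2 : nat -> R) :
  grows z r ->
  grows (fun N => japanese (x0 N)) a0 -> grows (fun N => japanese (y0 N)) e0 ->
  grows (fun N => japanese (x1 N)) a1 -> grows (fun N => japanese (y1 N)) e1 ->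
  grows (fun N => japanese (x2 N)) a2 -> grows (fun N => japanese (y2 N)) e2 ->
  (forall N, z N `^ rho * weight s0 b0 (x0 N) (y0 N) <=
     K * (weight s1 b1 (x1 N) (y1 N) * weight s2 b2 (x2 N) (y2 N))) ->
  r * rho + (a0 * s0 + e0 * b0) <= (a1 * s1 + e1 * b1) + (a2 * s2 + e2 * b2).
Proof.
move=> gz gx0 gy0 gx1 gy1 gx2 gy2; apply: grows_le.
  by apply: grows_mul; [exact: grows_powR|exact: grows_weight].
by apply: grows_mul; exact: grows_weight.
Qed.

End Compare.

Section Exponents.
Context {R : realType}.
Variables (alpha beta eps : R).
Hypotheses (halpha : 0 < alpha) (hbeta : 0 < beta) (heps : 0 < eps).
Implicit Types (s l b rho : R).

Local Notation pS := (phaseS alpha eps).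
Local Notation pW := (phaseW beta eps).
Local Notation mS := (modS alpha eps).
Local Notation mW := (modW beta eps).

Lemma grows_japanese_linear (a : R) (k : nat -> int) : 0 < a -> (forall N, `|(k N)%:~R| = a * N%:R) ->
  grows (fun N => japanese ((k N)%:~R : R)) 1.
Proof.
move=> a0 kE; apply: grows_japanese => //.
by apply: (@eq_grows _ (fun N => a * N%:R)) => //; exact: grows_natr.
Qed.

Lemma grows_japanese_phaseW (a : R) (y : nat -> R) : 0 < a -> (forall N, `|y N| = pW (a * N%:R)) ->
  grows (fun N => japanese (y N)) 2.
Proof.
move=> a0 yE; apply: grows_japanese => //.
by apply: (@eq_grows _ (fun N => pW (a * N%:R))) => //; exact: grows_phaseW.
Qed.

Lemma grows_japanese_phaseS_add (y : nat -> R) : (forall N, `|y N| = pS N%:R + pW N%:R) ->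
  grows (fun N => japanese (y N)) 4.
Proof.
move=> yE; apply: grows_japanese => //.
apply: (@eq_grows _ (fun N => pS N%:R + pW N%:R)) => //.
apply: (@grows_add _ _ _ _ 2); first by lra.
- exact: grows_phaseS.
- by apply: (@eq_grows _ (fun N => pW (1 * N%:R))); [move=> N; rewrite mul1r|exact: grows_phaseW].
- by move=> N; exact: phaseW_ge0.
Qed.

Lemma grows_japanese_phaseS_sub (y : nat -> R) : (forall N, y N = pS N%:R - pW N%:R) ->
  grows (fun N => japanese (y N)) 4.
Proof.
move=> yE; apply: grows_japanese => //.
apply: (@eq_grows _ (fun N => `|pS N%:R - pW N%:R|)); first by move=> N; rewrite yE.
apply: (@grows_dist _ _ _ _ 2); first by lra.
- exact: grows_phaseS.
- by apply: (@eq_grows _ (fun N => pW (1 * N%:R))); [move=> N; rewrite mul1r|exact: grows_phaseW].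
- by move=> N; exact: phaseW_ge0.
Qed.

Lemma phaseS_even (x : R) : pS (- x) = pS x.
Proof. by rewrite /phaseS; ring. Qed.

Lemma phaseS0 : pS 0 = 0.
Proof. by rewrite /phaseS; ring. Qed.

(** The four choices are: (-N, 2N) with the resonance w(2N) on the output, then
    on u; (0, N) with the resonance p(N) + w(N) on the output, then on u. *)
Lemma schrodinger_exponents s l b K :
  (forall k1 k2 tau1 tau2,
    weight s (b - 1) (k1 + k2)%:~R (mS (k1 + k2) (tau1 + tau2)) <=
    K * (weight s b k1%:~R (mS k1 tau1) * weight l b k2%:~R (mW k2 tau2))) ->
  [/\ 2 * (b - 1) <= l, - 2 * b <= l, s - l <= - 4 * (b - 1) & s - l <= 4 * b].
Proof.
move=> H.
have W0 (x : R) : 0 <= pW x by exact: phaseW_ge0.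
have S0 (x : R) : 0 <= pS x by exact: phaseS_ge0.
have kN (N : nat) : (- N%:Z)%:~R = - N%:R :> R by rewrite rmorphN/= -pmulrn.
have k2N (N : nat) : (2 * N%:Z)%:~R = 2 * N%:R :> R by rewrite rmorphM/= -!pmulrn.
have k1N (N : nat) : (- N%:Z + 2 * N%:Z)%:~R = N%:R :> R.
  by rewrite rmorphD/= kN k2N; ring.
have k01 (N : nat) : (0 + N%:Z)%:~R = N%:R :> R by rewrite add0r -pmulrn.
have kNN (N : nat) : (N%:Z)%:~R = N%:R :> R by rewrite -pmulrn.
have z1 : grows (fun=> 1 : R) 0 by exact: grows_cst.
(* No power of |k| appears here: the factor z of weight_compare is 1. *)
have H' k1 k2 tau1 tau2 : 1 `^ 0 * weight s (b - 1) (k1 + k2)%:~R (mS (k1 + k2) (tau1 + tau2)) <=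
    K * (weight s b k1%:~R (mS k1 tau1) * weight l b k2%:~R (mW k2 tau2)).
  by rewrite powRr0 mul1r.
have gN : grows (fun N => japanese ((- N%:Z)%:~R : R)) 1.
  by apply: (@grows_japanese_linear 1) => // N; rewrite kN normrN mul1r ger0_norm.
have g2N : grows (fun N => japanese ((2 * N%:Z)%:~R : R)) 1.
  by apply: (@grows_japanese_linear 2) => // N; rewrite k2N ger0_norm// mulr_ge0.
have g1N : grows (fun N => japanese ((- N%:Z + 2 * N%:Z)%:~R : R)) 1.
  by apply: (@grows_japanese_linear 1) => // N; rewrite k1N mul1r ger0_norm.
have g01 : grows (fun N => japanese ((0 + N%:Z)%:~R : R)) 1.
  by apply: (@grows_japanese_linear 1) => // N; rewrite k01 mul1r ger0_norm.
have gNN : grows (fun N => japanese ((N%:Z)%:~R : R)) 1.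
  by apply: (@grows_japanese_linear 1) => // N; rewrite kNN mul1r ger0_norm.
have gz : grows (fun N : nat => japanese ((0 : int)%:~R : R)) 0 by exact: grows_japanese0.
split.
- have := weight_compare z1 g1N _ gN _ g2N _
    (fun N => H' (- N%:Z) (2 * N%:Z) (- pS N%:R) (pW (2 * N%:R))).
  move=> /(_ 2 0 0) P; suff : 0 * 0 + (1 * s + 2 * (b - 1)) <= (1 * s + 0 * b) + (1 * l + 0 * b) by lra.
  apply: P.
  + by apply: (@grows_japanese_phaseW 2) => // N; rewrite modSE k1N addrAC addNr add0r ger0_norm.
  + by apply: grows_japanese0 => N; rewrite modSE kN phaseS_even addNr.
  + by apply: grows_japanese0 => N; rewrite modWE k2N ger0_norm// subrr.
- have := weight_compare z1 g1N _ gN _ g2N _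
    (fun N => H' (- N%:Z) (2 * N%:Z) (- pS N%:R - pW (2 * N%:R)) (pW (2 * N%:R))).
  move=> /(_ 0 2 0) P; suff : 0 * 0 + (1 * s + 0 * (b - 1)) <= (1 * s + 2 * b) + (1 * l + 0 * b) by lra.
  apply: P.
  + by apply: grows_japanese0 => N; rewrite modSE k1N subrK addNr.
  + by apply: (@grows_japanese_phaseW 2) => // N; rewrite modSE kN phaseS_even addrAC addNr add0r normrN ger0_norm.
  + by apply: grows_japanese0 => N; rewrite modWE k2N ger0_norm// subrr.
- have := weight_compare z1 g01 _ gz _ gNN _
    (fun N => H' 0 N%:Z 0 (pW N%:R)).
  move=> /(_ 4 0 0) P; suff : 0 * 0 + (1 * s + 4 * (b - 1)) <= (0 * s + 0 * b) + (1 * l + 0 * b) by lra.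
  apply: P.
  + by apply: grows_japanese_phaseS_add => N; rewrite modSE k01 add0r addrC ger0_norm// addr_ge0.
  + by apply: grows_japanese0 => N; rewrite modSE phaseS0 add0r.
  + by apply: grows_japanese0 => N; rewrite modWE kNN ger0_norm// subrr.
- have := weight_compare z1 g01 _ gz _ gNN _
    (fun N => H' 0 N%:Z (- (pS N%:R + pW N%:R)) (pW N%:R)).
  move=> /(_ 0 4 0) P; suff : 0 * 0 + (1 * s + 0 * (b - 1)) <= (0 * s + 4 * b) + (1 * l + 0 * b) by lra.
  apply: P.
  + by apply: grows_japanese0 => N; rewrite modSE k01; ring.
  + by apply: grows_japanese_phaseS_add => N; rewrite modSE phaseS0 addr0 normrN ger0_norm// addr_ge0.
  + by apply: grows_japanese0 => N; rewrite modWE kNN ger0_norm// subrr.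
Qed.

(** The four choices are: (N, -N) with the resonance w(2N) on the output, then
    on u; (N, 0) with the resonance p(N) - w(N) on the output, then p(N) + w(N)
    on u. *)
Lemma wave_exponents s l b rho K :
  (forall k1 k2 tau1 tau2,
    `|(k1 - k2)%:~R| `^ rho * weight l (b - 1) (k1 - k2)%:~R (mW (k1 - k2) (tau1 - tau2)) <=
    K * (weight s b k1%:~R (mS k1 tau1) * weight s b k2%:~R (mS k2 tau2))) ->
  [/\ 2 * (b - 1) <= 2 * s - l - rho, - 2 * b <= 2 * s - l - rho,
      rho + 4 * (b - 1) <= s - l & rho - 4 * b <= s - l].
Proof.
move=> H.
have W0 (x : R) : 0 <= pW x by exact: phaseW_ge0.
have S0 (x : R) : 0 <= pS x by exact: phaseS_ge0.
have kN (N : nat) : (- N%:Z)%:~R = - N%:R :> R by rewrite rmorphN/= -pmulrn.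
have kNN (N : nat) : (N%:Z)%:~R = N%:R :> R by rewrite -pmulrn.
have k2N (N : nat) : (N%:Z - - N%:Z)%:~R = 2 * N%:R :> R.
  by rewrite rmorphB/= kN kNN; ring.
have k10 (N : nat) : (N%:Z - 0)%:~R = N%:R :> R by rewrite subr0 -pmulrn.
have gN : grows (fun N => japanese ((- N%:Z)%:~R : R)) 1.
  by apply: (@grows_japanese_linear 1) => // N; rewrite kN normrN mul1r ger0_norm.
have g2N : grows (fun N => japanese ((N%:Z - - N%:Z)%:~R : R)) 1.
  by apply: (@grows_japanese_linear 2) => // N; rewrite k2N ger0_norm// mulr_ge0.
have g10 : grows (fun N => japanese ((N%:Z - 0)%:~R : R)) 1.
  by apply: (@grows_japanese_linear 1) => // N; rewrite k10 mul1r ger0_norm.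
have gNN : grows (fun N => japanese ((N%:Z)%:~R : R)) 1.
  by apply: (@grows_japanese_linear 1) => // N; rewrite kNN mul1r ger0_norm.
have gz : grows (fun N : nat => japanese ((0 : int)%:~R : R)) 0 by exact: grows_japanese0.
have z2 : grows (fun N => `|(N%:Z - - N%:Z)%:~R| : R) 1.
  apply: (@eq_grows _ (fun N => 2 * N%:R)); last exact: grows_natr.
  by move=> N; rewrite k2N ger0_norm// mulr_ge0.
have z1 : grows (fun N => `|(N%:Z - 0)%:~R| : R) 1.
  apply: (@eq_grows _ (fun N => 1 * N%:R)); last exact: grows_natr.
  by move=> N; rewrite k10 mul1r ger0_norm.
split.
- have := weight_compare z2 g2N _ gNN _ gN _
    (fun N => H N%:Z (- N%:Z) (- pS N%:R) (- pS N%:R)).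
  move=> /(_ 2 0 0) P; suff : 1 * rho + (1 * l + 2 * (b - 1)) <= (1 * s + 0 * b) + (1 * s + 0 * b) by lra.
  apply: P.
  + by apply: (@grows_japanese_phaseW 2) => // N; rewrite modWE k2N subrr normr0 add0r normrN ger0_norm.
  + by apply: grows_japanese0 => N; rewrite modSE kNN addNr.
  + by apply: grows_japanese0 => N; rewrite modSE kN phaseS_even addNr.
- have := weight_compare z2 g2N _ gNN _ gN _
    (fun N => H N%:Z (- N%:Z) (pW (2 * N%:R) - pS N%:R) (- pS N%:R)).
  move=> /(_ 0 2 0) P; suff : 1 * rho + (1 * l + 0 * (b - 1)) <= (1 * s + 2 * b) + (1 * s + 0 * b) by lra.
  apply: P.
  + by apply: grows_japanese0 => N; rewrite modWE k2N opprK subrK ger0_norm// subrr.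
  + by apply: (@grows_japanese_phaseW 2) => // N; rewrite modSE kNN subrK ger0_norm.
  + by apply: grows_japanese0 => N; rewrite modSE kN phaseS_even addNr.
- have := weight_compare z1 g10 _ gNN _ gz _
    (fun N => H N%:Z 0 (- pS N%:R) 0).
  move=> /(_ 4 0 0) P; suff : 1 * rho + (1 * l + 4 * (b - 1)) <= (1 * s + 0 * b) + (0 * s + 0 * b) by lra.
  apply: P.
  + by apply: grows_japanese_phaseS_sub => N; rewrite modWE k10 subr0 normrN ger0_norm.
  + by apply: grows_japanese0 => N; rewrite modSE kNN addNr.
  + by apply: grows_japanese0 => N; rewrite modSE phaseS0 add0r.
- have := weight_compare z1 g10 _ gNN _ gz _
    (fun N => H N%:Z 0 (pW N%:R) 0).
  move=> /(_ 0 4 0) P; suff : 1 * rho + (1 * l + 0 * (b - 1)) <= (1 * s + 4 * b) + (0 * s + 0 * b) by lra.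
  apply: P.
  + by apply: grows_japanese0 => N; rewrite modWE k10 subr0 ger0_norm// subrr.
  + by apply: grows_japanese_phaseS_add => N; rewrite modSE kNN addrC ger0_norm// addr_ge0.
  + by apply: grows_japanese0 => N; rewrite modSE phaseS0 add0r.
Qed.

End Exponents.

Theorem proposition4p3 (R : realType) (alpha beta eps : R)
    (halpha : 0 < alpha) (hbeta : 0 < beta) (heps : 0 < eps) :
  (forall s l b : R,
     (exists C : R, 0 < C /\
        forall u n : R * R -> R[i], test_fun u -> test_fun n ->
        (XS_norm alpha eps s (b - 1) (fun p => (u p * n p)%R)
         <= C%:E * XS_norm alpha eps s b u * XW_norm beta eps l b n)%E) ->
     (Num.max (2 * (b - 1)) (- 2 * b) <= l /\
      -1 <= Num.max (2 * (b - 1)) (- 2 * b)) /\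
     (s - l <= Num.min (- 4 * (b - 1)) (4 * b) /\
      Num.min (- 4 * (b - 1)) (4 * b) <= 2))
  /\
  (forall s l b rho : R, 0 < rho -> rho <= 1 ->
     (exists C : R, 0 < C /\
        forall u v : R * R -> R[i], test_fun u -> test_fun v ->
        (XW_norm beta eps l (b - 1) (absD rho (fun p => (u p * (v p)^*%C)%R))
         <= C%:E * XS_norm alpha eps s b u * XS_norm alpha eps s b v)%E) ->
     (Num.max (2 * (b - 1)) (- 2 * b) <= 2 * s - l - rho /\
      -1 <= Num.max (2 * (b - 1)) (- 2 * b)) /\
     (Num.max (rho + 4 * (b - 1)) (rho - 4 * b) <= s - l /\
      -2 + rho <= Num.max (rho + 4 * (b - 1)) (rho - 4 * b))).
Proof.
split=> [s l b H|s l b rho rho0 rho1 H].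
  have [K {}H] := schrodinger_necessary H.
  have [h1 h2 h3 h4] := schrodinger_exponents halpha hbeta heps H.
  split; first by rewrite ge_max h1 h2 le_max; split=> //; lra.
  by rewrite le_min h3 h4 ge_min; split=> //; lra.
have [K {}H] := wave_necessary H.
have [h1 h2 h3 h4] := wave_exponents halpha hbeta heps H.
split; first by rewrite ge_max h1 h2 le_max; split=> //; lra.
by rewrite ge_max h3 h4 le_max; split=> //; lra.
Qed.
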